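(* Let $F=F(q)$ be a smooth real function of one real variable with $F''(q)\neq 0$ for all $q$ in its domain. Let $J$ be the 5-manifold with coordinates $(x,y,p,q,z)$ ($q$ in the domain of $F$), and let $g_F$ be the $(3,2)$-signature metric on $J$ given by $$g_F=2\theta^1\theta^5-2\theta^2\theta^4+(\theta^3)^2,$$ where \begin{align*} \theta^1&=dy-p\,dx,\\ \theta^2&=dz-F\,dx-F'(dp-q\,dx),\\ \theta^3&=-\tfrac{2}{\sqrt3}(F'')^{1/3}(dp-q\,dx),\\ 30(F'')^{10/3}\theta^4&=\big(3F'F''F^{(4)}-4F'(F^{(3)})^2-10(F'')^2F^{(3)}\big)(dp-q\,dx)\\ &\quad+\big(4(F^{(3)})^2-3F''F^{(4)}\big)(dz-F\,dx)+30(F'')^3dx,\\ \theta^5&=-(F'')^{2/3}dq. \end{align*} Set $$P=\frac{4(F^{(3)})^2-3F''F^{(4)}}{90(F'')^{10/3}}.$$ Then the $(4,3)$-signature metric $$\tilde g_F=t^2g_F-2\,dt\,du-2tu\,(F'')^{4/3}P\,dq^2$$ on $J\times\mathbb{R}_+\times\mathbb{R}$, with coordinates $(x,y,p,q,z,t,u)$, $t>0$, is Ricci flat, $Ric(\tilde g_F)\equiv 0$, and it is the Fefferman–Graham ambient metric for $g_F$.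
   Context: Primes and superscripts $(k)$ on $F$ denote derivatives with respect to $q$. Fractional powers with denominator $3$ are real cube-root powers. Products of 1-forms such as $\theta^1\theta^5$ or $dt\,du$ are symmetric products, $\theta\eta=\tfrac12(\theta\otimes\eta+\eta\otimes\theta)$. Tensors on $J$ are pulled back to $J\times\mathbb{R}_+\times\mathbb{R}$ by the projection $(x,y,p,q,z,t,u)\mapsto(x,y,p,q,z)$, with the pullback sign omitted. The metric $g_F$ is a representative of the $(3,2)$-signature conformal class on $J$ associated with the ordinary differential equation $z'=F(y'')$, $F_{y''y''}\neq0$, for real functions $y(x),z(x)$ (with $p=y'$, $q=y''$); for the purposes of the statement $g_F$ is completely given by the displayed formulas. Fefferman–Graham ambient metric: given a metric $g$ on a 5-manifold $J$, consider all formal series $$-2\,dt\,du+t^2g-ut\,\alpha+u^2\beta+u^3t^{-1}\gamma+\sum_{k=4}^\infty u^kt^{2-k}\mu_k$$ on $J\times\mathbb{R}_+\times\mathbb{R}$ (coordinates $t>0$, $u$ on the last two factors), where $\alpha,\beta,\gamma,\mu_k$ are (pullbacks of) symmetric bilinear forms on $J$. By a theorem of Fefferman and Graham exactly one of these formal bilinear forms has vanishing Ricci tensor; it is called the ambient metric for $g$. *)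

(* Defs.v *)
From HB Require Import structures.
From mathcomp Require Import all_boot all_order all_algebra.
From mathcomp Require Import all_classical all_reals all_analysis.

Set Implicit Arguments.
Unset Strict Implicit.
Unset Printing Implicit Defensive.
#[local] Set Warnings "-redundant-canonical-projection".

Import Order.TTheory GRing.Theory Num.Theory.
Import numFieldNormedType.Exports.

Local Open Scope classical_set_scope.
Local Open Scope ring_scope.

(* Formal power series in one variable, with the Cauchy product. *)
Record fps (A : Type) := Fps { fcoef : nat -> A }.

HB.instance Definition _ (A : Type) := gen_eqMixin (fps A).
HB.instance Definition _ (A : Type) := gen_choiceMixin (fps A).

Lemma fpsP (A : Type) (a b : fps A) : (forall k, fcoef a k = fcoef b k) -> a = b.
Proof. by case: a b => [a] [b] /= ab; congr Fps; apply/funext. Qed.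

Section FpsRing.
Variable A : comNzRingType.
Implicit Types a b c : fps A.

Definition fps_zero : fps A := Fps (fun _ => 0).
Definition fps_one : fps A := Fps (fun k => (k == 0)%:R).
Definition fps_opp a : fps A := Fps (fun k => - fcoef a k).
Definition fps_add a b : fps A := Fps (fun k => fcoef a k + fcoef b k).
Definition fps_mul a b : fps A :=
  Fps (fun k => \sum_(i < k.+1) fcoef a i * fcoef b (k - i)).

Fact fps_addA : associative fps_add.
Proof. by move=> a b c; apply: fpsP => k /=; rewrite addrA. Qed.
Fact fps_addC : commutative fps_add.
Proof. by move=> a b; apply: fpsP => k /=; rewrite addrC. Qed.
Fact fps_add0 : left_id fps_zero fps_add.
Proof. by move=> a; apply: fpsP => k /=; rewrite add0r. Qed.
Fact fps_addN : left_inverse fps_zero fps_opp fps_add.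
Proof. by move=> a; apply: fpsP => k /=; rewrite addNr. Qed.

HB.instance Definition _ :=
  GRing.isZmodule.Build (fps A) fps_addA fps_addC fps_add0 fps_addN.

Let trunc n a : {poly A} := \poly_(i < n.+1) fcoef a i.

Let coef_trunc n a k : (k <= n)%N -> (trunc n a)`_k = fcoef a k.
Proof. by move=> kn; rewrite coef_poly ltnS kn. Qed.

Let trunc_mul n a b k :
  (k <= n)%N -> fcoef (fps_mul a b) k = (trunc n a * trunc n b)`_k.
Proof.
move=> kn; rewrite coefM; apply: eq_bigr => i _.
rewrite !coef_trunc ?(leq_trans (leq_subr _ _)) //.
by rewrite (leq_trans _ kn) // -ltnS.
Qed.

Fact fps_mulA : associative fps_mul.
Proof.
move=> a b c; apply: fpsP => k.
transitivity ((trunc k a * (trunc k b * trunc k c))`_k).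
  rewrite coefM; apply: eq_bigr => i _; rewrite coef_trunc -1?ltnS //.
  by rewrite -(trunc_mul b c (leq_subr i k)).
rewrite mulrA coefM; apply: eq_bigr => i _.
by rewrite coef_trunc ?leq_subr // -trunc_mul // -ltnS.
Qed.

Fact fps_mulC : commutative fps_mul.
Proof.
by move=> a b; apply: fpsP => k; rewrite !(trunc_mul _ _ (leqnn k)) mulrC.
Qed.

Fact fps_mul1 : left_id fps_one fps_mul.
Proof.
move=> a; apply: fpsP => k /=; rewrite big_ord_recl /= subn0 mul1r.
by rewrite big1 ?addr0 // => i _; rewrite mul0r.
Qed.

Fact fps_mulDl : left_distributive fps_mul fps_add.
Proof.
move=> a b c; apply: fpsP => k /=; rewrite -big_split /=.
by apply: eq_bigr => i _; rewrite mulrDl.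
Qed.

Fact fps_one_neq0 : fps_one != 0.
Proof.
apply/eqP => /(congr1 (fun a => fcoef a 0)) /= /eqP.
by rewrite oner_eq0.
Qed.

HB.instance Definition _ := GRing.Zmodule_isComNzRing.Build (fps A)
  fps_mulA fps_mulC fps_mul1 fps_mulDl fps_one_neq0.

Definition fps_unit : {pred fps A} := fun a => `[< exists b, b * a = 1 >].
Definition fps_inv a : fps A :=
  if pselect (exists b, b * a = 1) is left ex then projT1 (cid ex) else a.

Fact fps_mulV : {in fps_unit, left_inverse 1 fps_inv *%R}.
Proof.
move=> a /asboolP ex; rewrite /fps_inv.
by case: pselect => // ex'; case: cid.
Qed.

Fact fps_unitPl a b : b * a = 1 -> fps_unit a.
Proof. by move=> ba; apply/asboolP; exists b. Qed.

Fact fps_inv_out : {in [predC fps_unit], fps_inv =1 id}.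
Proof.
move=> a /negP na; rewrite /fps_inv; case: pselect => // ex.
by case: na; apply/asboolP.
Qed.

HB.instance Definition _ := GRing.ComNzRing_hasMulInverse.Build (fps A)
  fps_mulV fps_unitPl fps_inv_out.

End FpsRing.

(* The Ricci tensor in coordinates, for a metric whose components are
   functions on X with values in A and operators D i on such functions playing
   the role of the coordinate derivatives.  It is used both for genuine
   metrics (A = R) and for metrics given by formal series (A = fps R). *)
Section Ricci.
Variables (A : comUnitRingType) (X : Type) (n : nat).
Variables (D : 'I_n -> (X -> A) -> X -> A) (G : X -> 'M[A]_n).

Definition christoffel (k i j : 'I_n) (w : X) : A :=
  2^-1 * \sum_l invmx (G w) k l *
    (D i (fun v => G v j l) w + D j (fun v => G v i l) w
     - D l (fun v => G v i j) w).

Definition ricci (i j : 'I_n) (w : X) : A :=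
  \sum_k (D k (christoffel k i j) w - D j (christoffel k i k) w
    + \sum_l (christoffel k k l w * christoffel l i j w
              - christoffel k j l w * christoffel l i k w)).
End Ricci.

Section Calculus.
Variable R : realType.

Definition partial (n : nat) (i : 'I_n.+1) (f : 'rV[R]_n.+1 -> R)
  (w : 'rV[R]_n.+1) : R := 'D_(delta_mx 0 i) f w.

(* C^oo on an open set: every iterated partial derivative is differentiable. *)
Definition smooth_on (n : nat) (D : set 'rV[R]_n.+1) (f : 'rV[R]_n.+1 -> R) :=
  forall (s : seq 'I_n.+1) (w : 'rV[R]_n.+1), D w ->
    differentiable (foldr (@partial n) f s) w.

(* C^oo on an open subset of the line *)
Definition smooth1_on (U : set R) (F : R -> R) :=
  forall (n : nat) (q : R), U q -> derivable (derive1n n F) q 1.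

Definition cbrt (a : R) : R := Num.sg a * `|a| `^ (3^-1).

(* 1-forms are row vectors of components; symprod is the symmetric product
   (a tensor b + b tensor a) / 2 *)
Definition symprod (n : nat) (a b : 'rV[R]_n) : 'M[R]_n :=
  2^-1 *: (a^T *m b + b^T *m a).

Definition has_signature (r s : nat) (b : 'M[R]_(r + s)) :=
  exists2 B : 'M[R]_(r + s), B \in unitmx &
    B^T *m b *m B = block_mx 1%:M 0 0 (- 1%:M).

End Calculus.

Arguments has_signature {R} r s b.

Section AmbientSpace.
Variable R : realType.

(* Points of J are rows (x, y, p, q, z); points of J x R_+ are rows
   (x, y, p, q, z, t); points of J x R_+ x R are rows (x, y, p, q, z, t, u). *)

Definition Jset (U : set R) : set 'rV[R]_5 := [set v | U (v 0 3)].

Definition Jproj6 (w : 'rV[R]_6) : 'rV[R]_5 := lsubmx (w : 'rV_(5 + 1)).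
Definition Jproj7 (w : 'rV[R]_7) : 'rV[R]_5 := lsubmx (w : 'rV_(5 + 2)).
Definition proj76 (w : 'rV[R]_7) : 'rV[R]_6 := lsubmx (w : 'rV_(6 + 1)).

Definition JRset (U : set R) : set 'rV[R]_6 :=
  [set w | Jset U (Jproj6 w) /\ 0 < w 0 5].
Definition JRRset (U : set R) : set 'rV[R]_7 :=
  [set w | Jset U (Jproj7 w) /\ 0 < w 0 5].

(* Pullback along J x R_+ x R -> J of a bilinear form at a point of J *)
Definition pull (b : 'M[R]_5) : 'M[R]_7 :=
  block_mx b 0 0 (0 : 'M[R]_2).

Definition dt : 'rV[R]_7 := delta_mx 0 5.
Definition du : 'rV[R]_7 := delta_mx 0 6.

(* Formal series in u with coefficients functions of (x, y, p, q, z, t):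
   differentiation is coefficientwise in the first six coordinates
   and formal in u. *)
Definition formal_partial (i : 'I_7) (f : 'rV[R]_6 -> fps R)
    (w : 'rV[R]_6) : fps R :=
  match @fintype.split 6 1 i with
  | inl i' => Fps (fun k => partial i' (fun v => fcoef (f v) k) w)
  | inr _ => Fps (fun k => k.+1%:R * fcoef (f w) k.+1)
  end.

(* The coefficients of a series -2 dt du + \sum_k u^k t^(2-k) mu_k, that is
   mu_0 = g, mu_1 = - alpha, mu_2 = beta, mu_3 = gamma. *)
Definition FG_coefficients (U : set R) (g : 'rV[R]_5 -> 'M[R]_5)
    (mu : nat -> 'rV[R]_5 -> 'M[R]_5) :=
  (forall v, Jset U v -> mu 0%N v = g v) /\
  (forall k, (forall v, Jset U v -> (mu k v)^T = mu k v) /\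
             (forall i j, smooth_on (Jset U) (fun v => mu k v i j))).

Definition FG_series (mu : nat -> 'rV[R]_5 -> 'M[R]_5)
    (w : 'rV[R]_6) : 'M[fps R]_7 :=
  \matrix_(i, j) Fps (fun k =>
    ((if k is 0%N then - 2 *: symprod dt du else 0)
     + w 0 5 ^ (2%:Z - k%:Z) *: pull (mu k (Jproj6 w))) i j).

Definition FG_ricci_flat (U : set R) (mu : nat -> 'rV[R]_5 -> 'M[R]_5) :=
  forall (w : 'rV[R]_6), JRset U w ->
    forall i j, ricci formal_partial (FG_series mu) i j w = 0.

(* Gt is the sum of the formal series S in powers of the last coordinate. *)
Definition sum_of_series (U : set R) (S : 'rV[R]_6 -> 'M[fps R]_7)
    (Gt : 'rV[R]_7 -> 'M[R]_7) :=
  forall w : 'rV[R]_7, JRRset U w -> forall i j,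
    series (fun k => fcoef (S (proj76 w) i j) k * w 0 6 ^+ k) @ \oo
      --> Gt w i j.

(* Gt is the sum of a Ricci flat series of the Fefferman-Graham form for g,
   and this series is the only one. *)
Definition is_ambient_metric (U : set R) (g : 'rV[R]_5 -> 'M[R]_5)
    (Gt : 'rV[R]_7 -> 'M[R]_7) :=
  exists mu : nat -> 'rV[R]_5 -> 'M[R]_5,
    [/\ FG_coefficients U g mu,
        FG_ricci_flat U mu,
        (forall nu, FG_coefficients U g nu -> FG_ricci_flat U nu ->
           forall k v, Jset U v -> nu k v = mu k v)
      & sum_of_series U (FG_series mu) Gt].

End AmbientSpace.

Section TheMetric.
Variables (R : realType) (F : R -> R).

Let dx : 'rV[R]_5 := delta_mx 0 0.
Let dy : 'rV[R]_5 := delta_mx 0 1.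
Let dp : 'rV[R]_5 := delta_mx 0 2.
Let dq : 'rV[R]_5 := delta_mx 0 3.
Let dz : 'rV[R]_5 := delta_mx 0 4.

Let F0 := F.
Let F1 := derive1n 1 F.
Let F2 := derive1n 2 F.
Let F3 := derive1n 3 F.
Let F4 := derive1n 4 F.

Definition theta1 (v : 'rV[R]_5) : 'rV[R]_5 :=
  let p := v 0 2 in
  dy - p *: dx.

Definition theta2 (v : 'rV[R]_5) : 'rV[R]_5 :=
  let q := v 0 3 in
  dz - F0 q *: dx - F1 q *: (dp - q *: dx).

Definition theta3 (v : 'rV[R]_5) : 'rV[R]_5 :=
  let q := v 0 3 in
  - (2 / Num.sqrt 3 * cbrt (F2 q)) *: (dp - q *: dx).

Definition theta4 (v : 'rV[R]_5) : 'rV[R]_5 :=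
  let q := v 0 3 in
  (30 * cbrt (F2 q) ^+ 10)^-1 *:
    ((3 * F1 q * F2 q * F4 q - 4 * F1 q * F3 q ^+ 2 - 10 * F2 q ^+ 2 * F3 q)
        *: (dp - q *: dx)
     + (4 * F3 q ^+ 2 - 3 * F2 q * F4 q) *: (dz - F0 q *: dx)
     + (30 * F2 q ^+ 3) *: dx).

Definition theta5 (v : 'rV[R]_5) : 'rV[R]_5 :=
  let q := v 0 3 in
  - cbrt (F2 q) ^+ 2 *: dq.

Definition g_metric (v : 'rV[R]_5) : 'M[R]_5 :=
  2 *: symprod (theta1 v) (theta5 v) - 2 *: symprod (theta2 v) (theta4 v)
  + symprod (theta3 v) (theta3 v).

Definition P_fun (q : R) : R :=
  (4 * F3 q ^+ 2 - 3 * F2 q * F4 q) / (90 * cbrt (F2 q) ^+ 10).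

Definition gt_metric (w : 'rV[R]_7) : 'M[R]_7 :=
  let v := Jproj7 w in
  let q := v 0 3 in
  let t := w 0 5 in
  let u := w 0 6 in
  t ^+ 2 *: pull (g_metric v) - 2 *: symprod (dt R) (du R)
  - (2 * t * u * cbrt (F2 q) ^+ 4 * P_fun q) *: pull (symprod dq dq).

End TheMetric.

(* Main.v *)
Require Import Defs.
From Stdlib Require QArith_base Qreduction.
From HB Require Import structures.
From mathcomp Require Import all_boot all_order all_algebra.
From mathcomp Require Import all_classical all_reals all_analysis.
From mathcomp Require Import ssrZ zify ring.

(** Existence.  Every component of g_F and of the candidate ambient metric lies
   in the differential ring Q[t, 1/t, f, 1/f, u, p, q, F, F', F^(3), ...] where
   f = (F'')^(1/3), with f' = F^(3) / (3 f^2).  Evaluation of this ring, in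
   functions of the coordinates or in formal series in u, commutes with the
   ring operations and the derivations, so smoothness is clear, and both Ricci
   tensors vanish as soon as they vanish in that ring, which is decided by
   normalising polynomials.  The inverse metric is supplied by the frame dual
   to the theta^i; since dq is null, it is polynomial in u.

   Uniqueness.  A Fefferman-Graham series has the block form H - 2 dt du, with
   H = t^2 g - u t alpha + ..., for which Ric_ij and Ric_uu have closed
   expressions in H, its inverse and its derivatives.  If two solutions agree
   below order u^m and differ by Phi at order u^m, then the coefficient of
   u^(m-1) in the equations Ric_ij = 0 gives, at t = 1,
     m (5/2 - m) Phi + (m/2) tr_g(Phi) g = 0,
   and for m > 1 the coefficient of u^(m-2) in Ric_uu = 0 gives tr_g(Phi) = 0.
   Hence Phi = 0. *)

Set Implicit Arguments.
Unset Strict Implicit.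
Unset Printing Implicit Defensive.

Import Order.TTheory GRing.Theory Num.Theory.
Import numFieldNormedType.Exports.

Local Open Scope classical_set_scope.
Local Open Scope ring_scope.

(** * Polynomials in invertible and free atoms *)

Local Notation Q := QArith_base.Q.
Local Notation Qnat n := (QArith_base.Qmake (BinInt.Z.of_nat n) BinNums.xH).
Local Notation Qinvn n :=
  (QArith_base.Qmake (BinInt.Z.of_nat 1) (BinPos.Pos.of_nat n)).

Section RationalCoefficients.

(** Flatness is needed twice, for a genuine metric and for a formal series. The curvature is
    therefore computed once, in a ring where F, F', F^(3), ... are independent unknowns; only the
    valuation changes. Normalisation is proved sound, and each cancellation is certified by the
    result being the empty list.

    For uniqueness, the inverse of -2 dt du is off-diagonal, so a term of Ric_ij that contains d/du
    contains it once, paired with one d/dt. Since mu_k comes with t^(2-k), d/dt acts at t = 1 as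
    multiplication by 2 - k, and comparing two solutions becomes linear algebra at a point. The
    factor 5/2 - m never vanishes because the dimension 5 is odd. The g-trace of the equation for
    Phi is m (5 - m) tr_g(Phi) = 0, which is void exactly at m = 5; this is why Ric_uu is brought
    in. At m = 1, where Ric_uu has no coefficient to offer, the trace gives 4 tr_g(Phi) = 0. *)

Definition Qval (K : numFieldType) (q : Q) : K :=
  (int_of_Z (QArith_base.Qnum q))%:~R /
  (int_of_Z (BinNums.Zpos (QArith_base.Qden q)))%:~R.

Variable K : numFieldType.
Implicit Types q r : Q.

Let den_neq0 p : (int_of_Z (BinNums.Zpos p))%:~R != 0 :> K.
Proof. by rewrite intr_eq0; apply/eqP => /(congr1 Z_of_int); rewrite int_of_ZK. Qed.

Lemma Qval_eq q r : QArith_base.Qeq q r -> Qval K q = Qval K r.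
Proof.
move=> qr; apply/eqP; rewrite /Qval eqr_div //; apply/eqP.
by rewrite -!intrM -!rmorphM /=; congr (int_of_Z _)%:~R.
Qed.

Lemma Qval_red q : Qval K (Qreduction.Qred q) = Qval K q.
Proof. exact/Qval_eq/Qreduction.Qred_correct. Qed.

Lemma QvalD q r : Qval K (QArith_base.Qplus q r) = Qval K q + Qval K r.
Proof.
rewrite /Qval addf_div // -!intrM -!rmorphM -intrD -rmorphD.
by congr ((int_of_Z _)%:~R / (int_of_Z _)%:~R).
Qed.

Lemma QvalM q r : Qval K (QArith_base.Qmult q r) = Qval K q * Qval K r.
Proof.
rewrite /Qval mulf_div -!intrM -!rmorphM.
by congr ((int_of_Z _)%:~R / (int_of_Z _)%:~R).
Qed.

Lemma QvalN q : Qval K (QArith_base.Qopp q) = - Qval K q.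
Proof. by rewrite /Qval /= rmorphN /= intrN mulNr. Qed.

Lemma Qval_nat n : Qval K (Qnat n) = n%:R.
Proof. by rewrite /Qval /= divr1 (_ : int_of_Z _ = n) //; lia. Qed.

Lemma Qval_invn n : Qval K (Qinvn n.+1) = n.+1%:R^-1.
Proof.
transitivity ((1%:Z)%:~R / (BinPos.Pos.to_nat (BinPos.Pos.of_nat n.+1))%:R : K).
  by [].
by rewrite Pnat.Nat2Pos.id // mul1r.
Qed.

End RationalCoefficients.

Definition monom := seq nat.
Definition spoly := seq (monom * Q).

(** Lexicographic order up to trailing zeros, since one monomial may be represented by exponent
    lists of different lengths. The recursion is structural in the second list, so the case where
    that list is exhausted needs the inner fixpoint. *)
Fixpoint mcmp (m n : monom) : comparison :=
  match m, n with
  | [::], [::] => Eq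
  | [::], e :: n' => if e is 0%N then mcmp [::] n' else Lt
  | d :: m', [::] =>
    if d is 0%N then (fix zero m := match m with
      | [::] => Eq | d :: m' => if d is 0%N then zero m' else Gt end) m' else Gt
  | d :: m', e :: n' => if d == e then mcmp m' n' else if (d < e)%N then Lt else Gt
  end.

Fixpoint maddn (m n : monom) : monom :=
  match m, n with
  | [::], _ => n
  | _, [::] => m
  | d :: m', e :: n' => (d + e)%N :: maddn m' n'
  end.

(* Atoms 0, 1 and atoms 2, 3 are mutually inverse. *)
Definition mcancel (m : monom) : monom :=
  let e := nth 0%N m in
  let x := minn (e 0%N) (e 1%N) in let y := minn (e 2%N) (e 3%N) in
  [:: e 0%N - x, e 1%N - x, e 2%N - y, e 3%N - y & drop 4 m]%N.

Definition mmul m n := mcancel (maddn m n).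

(** Merge of lists sorted by [mcmp]. Vanishing coefficients are dropped, so a sum that cancels
    becomes [[::]] and [nilp] can test it. *)
Fixpoint padd (p : spoly) : spoly -> spoly :=
  fix padd_p (q : spoly) : spoly :=
  match p, q with
  | [::], _ => q
  | _, [::] => p
  | (m, c) :: p', (n, d) :: q' =>
    match mcmp m n with
    | Lt => (m, c) :: padd p' q
    | Gt => (n, d) :: padd_p q'
    | Eq => let e := Qreduction.Qred (QArith_base.Qplus c d) in
      if QArith_base.Qnum e is BinNums.Z0 then padd p' q' else (m, e) :: padd p' q'
    end
  end.

Lemma padd_cons m c p n d q : padd ((m, c) :: p) ((n, d) :: q) =
  match mcmp m n with
  | Lt => (m, c) :: padd p ((n, d) :: q)
  | Gt => (n, d) :: padd ((m, c) :: p) q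
  | Eq => let e := Qreduction.Qred (QArith_base.Qplus c d) in
    if QArith_base.Qnum e is BinNums.Z0 then padd p q else (m, e) :: padd p q
  end.
Proof. by []. Qed.

Arguments padd : simpl never.
Arguments mmul : simpl never.
Arguments Qreduction.Qred : simpl never.

Definition pmul (p q : spoly) : spoly :=
  foldr (fun x r => foldr (fun y r =>
    padd [:: (mmul x.1 y.1, Qreduction.Qred (QArith_base.Qmult x.2 y.2))] r) r q)
  [::] p.

Definition popp (p : spoly) : spoly :=
  [seq (x.1, QArith_base.Qopp x.2) | x <- p].

Definition pnat n : spoly := [:: ([::], Qnat n)].

Definition pinvn n : spoly := [:: ([::], Qinvn n)].

Definition pexp (p : spoly) n : spoly := iter n (pmul p) (pnat 1).

Definition patom k : spoly := [:: (ncons k 0%N [:: 1%N], Qnat 1)].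

Definition psum n (f : nat -> spoly) : spoly :=
  foldr (fun i r => padd (f i) r) [::] (iota 0 n).

Arguments pmul : simpl never.
Arguments popp : simpl never.
Arguments pnat : simpl never.
Arguments pinvn : simpl never.
Arguments patom : simpl never.
Arguments pexp : simpl never.

(** Leibniz rule on an exponent list whose head belongs to atom [k]. The padding by [ncons k 0]
    restores absolute positions, because the recursion only sees a suffix of the monomial. *)
Fixpoint mder (d : nat -> spoly) k (m : monom) : spoly :=
  if m is e :: m' then
    padd (if e is e'.+1 then
            pmul [:: (ncons k 0%N (e' :: m'),
                      Qnat e)] (d k)
          else [::])
         (pmul [:: (ncons k 0%N [:: e], Qnat 1)] (mder d k.+1 m'))
  else [::].

Definition pder (d : nat -> spoly) (p : spoly) : spoly :=
  foldr (fun x r => padd (pmul [:: ([::], x.2)] (mder d 0 x.1)) r) [::] p.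

Section Evaluation.
Variables (K : numFieldType) (A : comNzRingType) (c : {rmorphism K -> A}).
Variable a : nat -> A.
Hypotheses (a01 : a 0%N * a 1%N = 1) (a23 : a 2 * a 3 = 1).

Fixpoint meval k (m : monom) : A :=
  if m is e :: m' then a k ^+ e * meval k.+1 m' else 1.

Definition peval (p : spoly) : A :=
  foldr (fun x r => c (Qval K x.2) * meval 0 x.1 + r) 0 p.

Lemma peval_cons x p : peval (x :: p) = c (Qval K x.2) * meval 0 x.1 + peval p.
Proof. by []. Qed.

Lemma peval1 x : peval [:: x] = c (Qval K x.2) * meval 0 x.1.
Proof. by rewrite peval_cons addr0. Qed.

Lemma meval_mcmp m n : mcmp m n = Eq -> forall k, meval k m = meval k n.
Proof.
elim: m n => [|d m IH] [|e n] //=.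
- case: e => // /[swap] k; rewrite expr0 mul1r.
  elim: n k.+1 => //= -[|//] n IHn j; rewrite expr0 mul1r.
  exact: IHn.
- case: d => // /[swap] k; rewrite expr0 mul1r => h {IH}.
  elim: m h k.+1 => //= -[|//] m IHm h j; rewrite expr0 mul1r.
  exact: IHm.
- case: eqP => [->|_]; last by case: ifP.
  by move=> /IH h k; rewrite h.
Qed.

Lemma meval_maddn k m n : meval k (maddn m n) = meval k m * meval k n.
Proof.
elim: m n k => [|d m IH] [|e n] k //=; rewrite ?mul1r ?mulr1 //.
by rewrite IH exprD; ring.
Qed.

Lemma meval_drop4 m : meval 0 m =
  a 0%N ^+ nth 0%N m 0 * a 1%N ^+ nth 0%N m 1 * (a 2 ^+ nth 0%N m 2%N
  * a 3 ^+ nth 0%N m 3%N) * meval 4 (drop 4 m).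
Proof.
by case: m => [|e0 [|e1 [|e2 [|e3 m]]]]; rewrite /= ?drop0 ?expr0 ?mul1r ?mulr1
  ?mulrA.
Qed.

Lemma expr_cancel (x y : A) m n k : x * y = 1 -> (k <= m)%N -> (k <= n)%N ->
  x ^+ (m - k) * y ^+ (n - k) = x ^+ m * y ^+ n.
Proof.
move=> xy km kn; rewrite -{2}(subnK km) -{2}(subnK kn) !exprD.
transitivity (x ^+ (m - k) * y ^+ (n - k) * (x * y) ^+ k).
  by rewrite xy expr1n mulr1.
by rewrite exprMn; ring.
Qed.

Lemma meval_mmul m n : meval 0 (mmul m n) = meval 0 m * meval 0 n.
Proof.
rewrite -meval_maddn /mmul [RHS]meval_drop4 /mcancel.
move: (maddn m n) => l /=; rewrite mulrA (mulrA (a 2 ^+ _)).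
by rewrite !expr_cancel ?geq_minl ?geq_minr // mulrA.
Qed.

Lemma peval_add p q : peval (padd p q) = peval p + peval q.
Proof.
elim: p q => [|[m k] p IHp]; first by case=> *; rewrite add0r.
elim=> [|[n l] q IHq]; first by rewrite addr0.
rewrite padd_cons; case mn: (mcmp m n).
- set e := Qreduction.Qred _.
  have ke : Qval K e = Qval K k + Qval K l by rewrite Qval_red QvalD.
  rewrite !peval_cons /= (meval_mcmp mn) addrACA -mulrDl -rmorphD -ke -IHp.
  rewrite -(meval_mcmp mn).
  case E: (QArith_base.Qnum e) => [|z|z]; rewrite ?peval_cons //.
  by rewrite (_ : Qval K e = 0) ?rmorph0 ?mul0r ?add0r // /Qval E mul0r.
- by rewrite !peval_cons IHp peval_cons addrA.
- by rewrite !peval_cons IHq peval_cons addrCA.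
Qed.

Lemma peval_mul p q : peval (pmul p q) = peval p * peval q.
Proof.
elim: p => [|x p IH]; first by rewrite mul0r.
rewrite peval_cons mulrDl -IH /pmul [foldr _ _ (_ :: _)]/= -/(pmul p q).
move: (pmul p q) => r {IH p}.
elim: q => [|y q IH]; first by rewrite /= mulr0 add0r.
rewrite [foldr _ _ (_ :: _)]/= peval_add IH peval1 peval_cons Qval_red QvalM.
by rewrite meval_mmul rmorphM; ring.
Qed.

Lemma peval_opp p : peval (popp p) = - peval p.
Proof.
elim: p => [|x p IH]; first by rewrite oppr0.
by rewrite [LHS]peval_cons peval_cons QvalN IH opprD rmorphN mulNr.
Qed.

Lemma peval_nil : peval [::] = 0.
Proof. by []. Qed.

Lemma peval_nat n : peval (pnat n) = n%:R.
Proof. by rewrite /= mulr1 addr0 Qval_nat rmorph_nat. Qed.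

Lemma peval_invn n : peval (pinvn n.+1) = c n.+1%:R^-1.
Proof. by rewrite [LHS]/= mulr1 addr0 Qval_invn. Qed.

Lemma meval_ncons j k m : meval j (ncons k 0%N m) = meval (j + k) m.
Proof.
elim: k j => [|k IH] j; first by rewrite addn0.
by rewrite /= expr0 mul1r IH addSnnS.
Qed.

Lemma peval_atom k : peval (patom k) = a k.
Proof.
by rewrite /= addr0 meval_ncons /= (Qval_nat _ 1) rmorph1 mul1r expr1 mulr1.
Qed.

Lemma peval_sum n f : peval (psum n f) = \sum_(i < n) peval (f i).
Proof.
rewrite -(big_mkord predT (peval \o f)) /psum /index_iota subn0.
elim: (iota 0 n) => [|i s IH]; first by rewrite big_nil.
by rewrite /= peval_add IH big_cons.
Qed.

Lemma peval_exp p n : peval (pexp p n) = peval p ^+ n.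
Proof.
elim: n => [|n IH]; first by rewrite peval_nat expr0.
by rewrite /pexp iterS peval_mul IH exprS.
Qed.

(* The order matters: [pexp] unfolds to [pmul] and [pmul] to [padd]. *)
Definition pevalE := (peval_exp, peval_mul, peval_add, peval_opp, peval_atom,
  peval_nat, peval_invn, peval_nil).

End Evaluation.

Arguments peval : simpl never.

Definition pfree k (p : spoly) := all (fun x => nth 0%N x.1 k == 0%N) p.

Section Transport.
Variables (K : numFieldType) (A B : comNzRingType).
Variables (c : {rmorphism K -> A}) (f : {rmorphism A -> B}).

(** Allows the value of one absent atom to be changed. It is applied to the atom u, which becomes
    the formal variable in series while the coefficients do not involve it. *)
Lemma eq_peval k p (a b : nat -> A) : pfree k p ->
  (forall j, j != k -> a j = b j) -> peval c a p = peval c b p.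
Proof.
move=> + ab; elim: p => [//|[m r] p IH] /andP[mk /IH E].
rewrite !peval_cons {}E /=.
(* The induction runs over suffixes: when the head of [m] is the exponent of atom [i], atom [k] sits
   at position [k - i]. *)
suff h i : (i <= k -> nth 0 m (k - i) = 0)%N -> meval a i m = meval b i m.
  by rewrite h // subn0 => _; apply/eqP.
elim: m i {mk} => [//|e m IHm] i mk /=.
rewrite IHm => [|ik]; last by have := mk (ltnW ik); rewrite -subnSK.
have [ik|/ab-> //] := eqVneq i k.
by move: mk; rewrite ik subnn /= leqnn => ->.
Qed.

Lemma peval_rmorph (c' : {rmorphism K -> B}) (a : nat -> A) p :
  (forall r, c' r = f (c r)) -> peval c' (f \o a) p = f (peval c a p).
Proof.
move=> cc; elim: p => [|[m r] p IH]; first by rewrite rmorph0.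
rewrite !peval_cons /= IH cc rmorphD rmorphM; congr (_ * _ + _).
by elim: m 0%N => [|e m IHm] k /=; rewrite ?rmorph1 // rmorphM rmorphXn IHm.
Qed.

End Transport.

(** The rules are restricted to functions in [S] and points of [O] because a partial derivative is
    additive and Leibniz only on differentiable functions. [der_local] permits differentiating an
    identity known only on [O], which is how a component of the metric is replaced by its
    polynomial. *)
Record derivation (K A : nzRingType) (c : K -> A) (X : Type) (O : set X)
    (S : set (X -> A)) (D : (X -> A) -> X -> A) : Prop := Derivation {
  der_cst : forall r w, O w -> D (fun=> c r) w = 0;
  derD : forall f g, S f -> S g -> forall w, O w ->
    D (fun v => f v + g v) w = D f w + D g w;
  derM : forall f g, S f -> S g -> forall w, O w ->
    D (fun v => f v * g v) w = D f w * g w + f w * D g w;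
  der_local : forall f g, (forall w, O w -> f w = g w) ->
    forall w, O w -> D f w = D g w }.

Record function_ring (K A : nzRingType) (c : K -> A) (X : Type)
    (S : set (X -> A)) : Prop := FunctionRing {
  fring_cst : forall r, S (fun=> c r);
  fringD : forall f g, S f -> S g -> S (fun v => f v + g v);
  fringM : forall f g, S f -> S g -> S (fun v => f v * g v) }.

Section SymbolicDerivation.
Variables (K : numFieldType) (A : comNzRingType) (c : {rmorphism K -> A}).
Variables (X : Type) (O : set X) (S : set (X -> A)) (a : X -> nat -> A).
Hypothesis ringS : function_ring c S.
Hypothesis S_atom : forall k, S (a^~ k).
Hypotheses (a01 : forall w, O w -> a w 0%N * a w 1%N = 1)
           (a23 : forall w, O w -> a w 2 * a w 3 = 1).

Let S1 : S (fun=> 1).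
Proof. by have := fring_cst ringS 1; rewrite rmorph1. Qed.

Let SX k e : S (fun w => a w k ^+ e).
Proof.
elim: e => [//|e IH]; have := fringM ringS (S_atom k) IH.
by congr S; apply/funext => w; rewrite exprS.
Qed.

Lemma fring_meval k m : S (fun w => meval (a w) k m).
Proof.
elim: m k => [|e m IH] k //=.
exact: (fringM ringS (SX _ _)).
Qed.

Lemma fring_peval p : S (fun w => peval c (a w) p).
Proof.
elim: p => [|x p IH]; rewrite /peval /=.
  by have := fring_cst ringS 0; rewrite rmorph0.
apply: (fringD ringS _ IH); apply: (fringM ringS); first exact: (fring_cst ringS).
exact: fring_meval.
Qed.

Variables (D : (X -> A) -> X -> A) (d : nat -> spoly).
Hypothesis derivD : derivation c O S D.
Hypothesis D_atom :
  forall k w, O w -> D (a^~ k) w = peval c (a w) (d k).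

Let D1 w : O w -> D (fun=> 1) w = 0.
Proof. by move=> Ow; have := der_cst derivD 1 Ow; rewrite rmorph1. Qed.

Let DX k e w : O w ->
  D (fun w => a w k ^+ e) w = e%:R * a w k ^+ e.-1 * D (a^~ k) w.
Proof.
move=> Ow; elim: e => [|e IH]; first by rewrite D1 // !mul0r.
rewrite -[LHS](_ : D (fun w => a w k * a w k ^+ e) w = _); last first.
  by congr (D _ w); apply/funext => v; rewrite exprS.
rewrite (derM derivD (S_atom k) (SX k e)) // IH -[in e.+1%:R]addn1 natrD /=.
by case: e {IH} => [|e]; rewrite ?expr0 /= ?exprS; ring.
Qed.

Lemma der_meval k m w : O w ->
  D (fun w => meval (a w) k m) w = peval c (a w) (mder d k m).
Proof.
move=> Ow; elim: m k => [|e m IH] k; first exact: D1.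
rewrite [LHS](derM derivD (SX k e) (fring_meval k.+1 m)) // DX // IH.
rewrite D_atom // peval_add ?peval_mul ?a01 ?a23 //.
congr (_ + _); last first.
  by rewrite peval1 meval_ncons (Qval_nat K 1) rmorph1 /= mul1r mulr1.
case: e => [|e]; first by rewrite !mul0r.
rewrite peval_mul ?a01 ?a23 // peval1 meval_ncons.
by rewrite (Qval_nat K e.+1) rmorph_nat add0n /=; ring.
Qed.

Lemma der_peval p w : O w ->
  D (fun w => peval c (a w) p) w = peval c (a w) (pder d p).
Proof.
move=> Ow; elim: p => [|x p IH].
  by have := der_cst derivD 0 Ow; rewrite rmorph0.
rewrite [LHS](derD derivD _ (fring_peval p)) //; last first.
  by apply: (fringM ringS); [exact: (fring_cst ringS)|exact: fring_meval].
rewrite (derM derivD (fring_cst ringS _) (fring_meval 0 x.1)) //.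
rewrite (der_cst derivD) // mul0r add0r IH der_meval // [pder _ _]/= peval_add.
by rewrite peval_mul ?a01 ?a23 // peval1 mulr1.
Qed.

End SymbolicDerivation.

(* Symbolic Christoffel symbols and Ricci tensor *)
Declare Scope spoly_scope.
Delimit Scope spoly_scope with P.
Bind Scope spoly_scope with spoly.
Notation "p + q" := (padd p q) : spoly_scope.
Notation "- p" := (popp p) : spoly_scope.
Notation "p - q" := (padd p (popp q)) : spoly_scope.
Notation "p * q" := (pmul p q) : spoly_scope.
Notation "p ^+ n" := (pexp p n) : spoly_scope.

(* Tabulated, so that each component is computed only once. *)
Definition memo2 n (f : nat -> nat -> spoly) : nat -> nat -> spoly :=
  let s := mkseq (fun i => mkseq (f i) n) n in
  fun i j => nth [::] (nth [::] s i) j.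

Definition memo3 n (f : nat -> nat -> nat -> spoly) : nat -> nat -> nat -> spoly :=
  let s := mkseq (fun i => mkseq (fun j => mkseq (f i j) n) n) n in
  fun i j k => nth [::] (nth [::] (nth [::] s i) j) k.

Lemma memo2E n f (i j : 'I_n) : memo2 n f i j = f i j.
Proof. by rewrite /memo2 !nth_mkseq. Qed.

Lemma memo3E n f (i j k : 'I_n) : memo3 n f i j k = f i j k.
Proof. by rewrite /memo3 !nth_mkseq. Qed.

Definition pdelta (j i : nat) : spoly := if i == j then pnat 1 else [::].

Definition sym_christoffel n (dg : nat -> nat -> nat -> spoly)
    (gi : nat -> nat -> spoly) (k i j : nat) : spoly :=
  (pinvn 2 * psum n (fun l => gi k l * (dg i j l + dg j i l - dg l i j)))%P.

Definition sym_ricci n (d : nat -> nat -> spoly)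
    (gam : nat -> nat -> nat -> spoly) (i j : nat) : spoly :=
  psum n (fun k => pder (d k) (gam k i j) - pder (d j) (gam k i k)
    + psum n (fun l => gam k k l * gam l i j - gam k j l * gam l i k))%P.

Definition sym_ricci_flat n (d : nat -> nat -> spoly)
    (g gi : nat -> nat -> spoly) : bool :=
  let g := memo2 n g in
  let gi := memo2 n gi in
  let dg := memo3 n (fun k i j => pder (d k) (g i j)) in
  let gam := memo3 n (sym_christoffel n dg gi) in
  all (fun i => all (fun j => nilp (sym_ricci n d gam i j)) (iota 0 n)) (iota 0 n).

Definition sym_inverse n (g gi : nat -> nat -> spoly) : bool :=
  let g := memo2 n g in
  let gi := memo2 n gi in
  all (fun i => all (fun j =>
    nilp (psum n (fun l => g i l * gi l j) - pdelta j i)%P)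
    (iota 0 n)) (iota 0 n).

Lemma peval_delta (K : numFieldType) (A : comNzRingType)
    (c : {rmorphism K -> A}) a j i : peval c a (pdelta j i) = (i == j)%:R.
Proof. by rewrite /pdelta; case: eqP; rewrite // peval_nat. Qed.

Section SymbolicRicci.
Variables (K : numFieldType) (A : comUnitRingType) (c : {rmorphism K -> A}).
Variables (X : Type) (O : set X) (S : set (X -> A)) (a : X -> nat -> A).
Hypothesis ringS : function_ring c S.
Hypothesis S_atom : forall k, S (a^~ k).
Hypotheses (a01 : forall w, O w -> a w 0%N * a w 1%N = 1)
           (a23 : forall w, O w -> a w 2%N * a w 3%N = 1).
Variables (n : nat) (D : 'I_n -> (X -> A) -> X -> A) (d : nat -> nat -> spoly).
Hypothesis derivD : forall i, derivation c O S (D i).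
Hypothesis D_atom :
  forall i k w, O w -> D i (a^~ k) w = peval c (a w) (d i k).
Variable (G : X -> 'M[A]_n) (g gi : nat -> nat -> spoly).
Hypothesis G_eval : forall i j w, O w -> G w i j = peval c (a w) (g i j).

Local Notation ev w p := (peval c (a w) p).

Let D_eval (i : 'I_n) f p : (forall w, O w -> f w = ev w p) ->
  forall w, O w -> D i f w = ev w (pder (d i) p).
Proof.
move=> fp w Ow; rewrite (der_local (derivD i) fp Ow).
exact: (der_peval ringS S_atom a01 a23 (derivD i) (D_atom i)).
Qed.

Lemma sym_inverseP w : sym_inverse n g gi -> O w ->
  G w \in unitmx /\ invmx (G w) = \matrix_(i, j) ev w (gi i j).
Proof.
move=> ginv Ow; set I := \matrix_(i, j) _.
have GI : G w *m I = 1%:M.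
  apply/matrixP => i j; rewrite !mxE.
  have := ginv; rewrite /sym_inverse => /allP /(_ i).
  rewrite mem_iota ltn_ord => /(_ isT) /allP /(_ j).
  rewrite mem_iota ltn_ord => /(_ isT) /nilP /(congr1 (peval c (a w))).
  rewrite peval_add peval_sum peval_opp peval_delta => /eqP.
  rewrite subr_eq0 => /eqP <-; apply: eq_bigr => l _.
  by rewrite peval_mul ?a01 ?a23 // !memo2E G_eval // mxE.
have [Gu _] := mulmx1_unit GI; split=> //.
by rewrite -[LHS]mulmx1 -GI mulmxA mulVmx // mul1mx.
Qed.

Lemma eval_sym_christoffel (dg : nat -> nat -> nat -> spoly)
    (gi' : nat -> nat -> spoly) (k i j : 'I_n) w : O w ->
  (forall i j l : 'I_n, ev w (dg i j l) = D i (fun v => G v j l) w) ->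
  (forall i j : 'I_n, ev w (gi' i j) = invmx (G w) i j) ->
  ev w (sym_christoffel n dg gi' k i j) = christoffel D G k i j w.
Proof.
move=> Ow dgE giE; rewrite peval_mul ?a01 ?a23 // peval_invn peval_sum.
rewrite rmorphV ?unitfE ?pnatr_eq0 // rmorph_nat; congr (_ * _).
apply: eq_bigr => l _.
by rewrite peval_mul ?a01 ?a23 // !peval_add peval_opp giE !dgE.
Qed.

Lemma eval_sym_ricci (gam : nat -> nat -> nat -> spoly) (i j : 'I_n) w : O w ->
  (forall (k i j : 'I_n) w, O w -> ev w (gam k i j) = christoffel D G k i j w) ->
  ev w (sym_ricci n d gam i j) = ricci D G i j w.
Proof.
move=> Ow gamE; rewrite peval_sum; apply: eq_bigr => k _.
have D_gam l k' i' j' : D l (christoffel D G k' i' j') w =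
    ev w (pder (d l) (gam k' i' j')).
  by apply: D_eval => // v Ov; rewrite gamE.
rewrite !peval_add peval_opp !D_gam peval_sum; congr (_ + _).
apply: eq_bigr => l _.
by rewrite peval_add peval_opp !peval_mul ?a01 ?a23 // !gamE.
Qed.

(** Reflection principle: a boolean computation on polynomials gives flatness under every valuation
    that turns the table [d] into the derivations [D]. It is instantiated with functions of seven
    coordinates and with formal series in u. *)
Lemma sym_ricci_flatP w (i j : 'I_n) :
  sym_inverse n g gi -> sym_ricci_flat n d g gi -> O w -> ricci D G i j w = 0.
Proof.
move=> ginv + Ow; rewrite /sym_ricci_flat.
set gam := memo3 n (sym_christoffel _ _ _) => /allP /(_ i).
rewrite mem_iota ltn_ord => /(_ isT) /allP /(_ j).
rewrite mem_iota ltn_ord => /(_ isT) /nilP /(congr1 (peval c (a w))).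
rewrite (eval_sym_ricci _ _ Ow) // => k' i' j' v Ov.
rewrite /gam memo3E; apply: eval_sym_christoffel => // *.
  rewrite memo3E; symmetry; apply: D_eval => // u Ou.
  by rewrite memo2E G_eval.
by rewrite memo2E (sym_inverseP ginv Ov).2 mxE.
Qed.

End SymbolicRicci.

(** * The metric in the ring of atoms *)

(* Besides t, u, p, q and 1/t the atoms are f = (F'')^(1/3), 1/f and, at
   position 7 + k, the derivative F^(k).  F'' is always written f ^ 3.  The
   first argument of [datom] numbers the coordinates x, y, p, q, z, t, u. *)
Local Notation pt := (patom 0).
Local Notation ps := (patom 1).
Local Notation pf := (patom 2).
Local Notation ph := (patom 3).
Local Notation pu := (patom 4).
Local Notation pp := (patom 5).
Local Notation pq := (patom 6).
Local Notation pF k := (patom (7 + k)).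

Definition datom (i k : nat) : spoly :=
  match i with
  | 2%N => if k == 5%N then pnat 1 else [::]
  | 3%N => match k with
    | 2%N => pinvn 3 * (pF 3 * ph ^+ 2)
    | 3%N => - (pinvn 3 * (pF 3 * ph ^+ 4))
    | 6%N => pnat 1
    | 8%N => pf ^+ 3
    | _ => if (7 <= k)%N then patom k.+1 else [::]
    end
  | 5%N => match k with 0%N => pnat 1 | 1%N => - ps ^+ 2 | _ => [::] end
  | 6%N => if k == 4%N then pnat 1 else [::]
  | _ => [::]
  end%P.

Definition sym_contact (i : nat) : spoly := (pdelta 2 i - pq * pdelta 0 i)%P.

Definition sym_theta1 (i : nat) : spoly := (pdelta 1 i - pp * pdelta 0 i)%P.

Definition sym_theta2 (i : nat) : spoly :=
  (pdelta 4 i - pF 0 * pdelta 0 i - pF 1 * sym_contact i)%P.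

Definition sym_theta4 (i : nat) : spoly :=
  (pinvn 30 * ph ^+ 10 *
    ((pnat 3 * pF 1 * pf ^+ 3 * pF 4 - pnat 4 * pF 1 * pF 3 ^+ 2
      - pnat 10 * pf ^+ 6 * pF 3) * sym_contact i
     + (pnat 4 * pF 3 ^+ 2 - pnat 3 * pf ^+ 3 * pF 4)
       * (pdelta 4 i - pF 0 * pdelta 0 i)
     + pnat 30 * pf ^+ 9 * pdelta 0 i))%P.

Definition sym_theta5 (i : nat) : spoly := (- (pf ^+ 2 * pdelta 3 i))%P.

Definition sym_P : spoly :=
  (pinvn 90 * ph ^+ 10 * (pnat 4 * pF 3 ^+ 2 - pnat 3 * pf ^+ 3 * pF 4))%P.

Definition sym_g (i j : nat) : spoly :=
  (sym_theta1 i * sym_theta5 j + sym_theta5 i * sym_theta1 j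
   - (sym_theta2 i * sym_theta4 j + sym_theta4 i * sym_theta2 j)
   + pnat 4 * pinvn 3 * pf ^+ 2 * sym_contact i * sym_contact j)%P.

Definition sym_mu1 (i j : nat) : spoly :=
  (- (pnat 2 * pf ^+ 4 * sym_P * pdelta 3 i * pdelta 3 j))%P.

Definition sym_gt (i j : nat) : spoly :=
  (pt ^+ 2 * sym_g i j + pt * pu * sym_mu1 i j
   - (pdelta 5 i * pdelta 6 j + pdelta 6 i * pdelta 5 j))%P.

(* [sym_e2] to [sym_e5] and d/dy form the frame dual to the theta^i, with
   theta^3 replaced by dp - q dx. *)
Definition sym_total (i : nat) : spoly :=
  (pdelta 0 i + pp * pdelta 1 i + pq * pdelta 2 i + pF 0 * pdelta 4 i)%P.

(** The multiples of the total derivative are forced by theta^4, which takes the value 1/f on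
    [sym_total], 3 P on d/dz and -F^(3) / (3 f^4) on d/dp + F' d/dz. The term F' d/dz in [sym_e3]
    makes theta^2 vanish there. *)
Definition sym_e2 (i : nat) : spoly :=
  (pdelta 4 i - pnat 3 * sym_P * pf * sym_total i)%P.

Definition sym_e3 (i : nat) : spoly :=
  (pdelta 2 i + pF 1 * pdelta 4 i
   + pinvn 3 * pF 3 * ph ^+ 3 * sym_total i)%P.

Definition sym_e4 (i : nat) : spoly := (pf * sym_total i)%P.

Definition sym_e5 (i : nat) : spoly := (- (ph ^+ 2 * pdelta 3 i))%P.

(** The factor 3 / (4 f^2) inverts the coefficient 4 f^2 / 3 that (theta^3)^2 gives to the square of
    dp - q dx. *)
Definition sym_g_inv (i j : nat) : spoly :=
  (pdelta 1 i * sym_e5 j + sym_e5 i * pdelta 1 j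
   - (sym_e2 i * sym_e4 j + sym_e4 i * sym_e2 j)
   + pnat 3 * pinvn 4 * ph ^+ 2 * sym_e3 i * sym_e3 j)%P.

(** Neumann series of t^2 g + c dq^2 with c = -2 t u f^4 P, cut off after the linear term because dq
    is null. Raising the index of dq with g gives -f^(-2) d/dy, hence the correction -c t^(-4)
    f^(-4) = 2 u P / t^3 along the square of d/dy. *)
Definition sym_gt_inv (i j : nat) : spoly :=
  (ps ^+ 2 * sym_g_inv i j
   + pnat 2 * ps ^+ 3 * pu * sym_P * pdelta 1 i * pdelta 1 j
   - (pdelta 5 i * pdelta 6 j + pdelta 6 i * pdelta 5 j))%P.

Lemma sym_g_inverse : sym_inverse 5 sym_g sym_g_inv.
Proof. by vm_compute. Qed.

Lemma sym_gt_inverse : sym_inverse 7 sym_gt sym_gt_inv.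
Proof. by vm_compute. Qed.

Lemma sym_gt_ricci_flat : sym_ricci_flat 7 datom sym_gt sym_gt_inv.
Proof. by vm_compute. Qed.

(** * Derivatives of the atoms *)

Section CubeRoot.
Variable R : realType.
Implicit Types a : R.

Lemma cbrt_cube a : cbrt a ^+ 3 = a.
Proof.
rewrite /cbrt exprMn -[X in _ * X]powR_mulrn ?powR_ge0 // -powRrM.
rewrite mulVf ?pnatr_eq0 // powRr1 ?normr_ge0 //.
have [a0|a0|->] := ltrgt0P a.
- by rewrite gtr0_sg // expr1n mul1r.
- by rewrite ltr0_sg // exprS sqrrN expr1n !mulr1 mulN1r opprK.
- by rewrite mulr0.
Qed.

Lemma cbrt_neq0 a : a != 0 -> cbrt a != 0.
Proof. by have := expf_eq0 (cbrt a) 3; rewrite cbrt_cube /= => ->. Qed.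

Lemma cbrtN a : cbrt (- a) = - cbrt a.
Proof. by rewrite /cbrt sgrN normrN mulNr. Qed.

(** Near a positive point [cbrt] is a real power; oddness carries the formula over to negative
    points, which matter because F'' may have either sign. *)
Lemma is_derive_cbrt a : a != 0 -> is_derive a 1 (@cbrt R) (3^-1 * (cbrt a) ^- 2).
Proof.
have pos (b : R) : 0 < b -> is_derive b 1 (@cbrt R) (3^-1 * (cbrt b) ^- 2).
  move=> b0; apply: (@near_eq_is_derive _ _ _ (fun x : R => x `^ 3^-1)).
    near=> x; rewrite /cbrt.
    have x0 : 0 < x by near: x; exact: lt_nbhsr.
    by rewrite gtr0_sg // gtr0_norm // mul1r.
  apply: is_derive_eq; first exact: is_derive1_powR.
  rewrite /cbrt gtr0_sg // gtr0_norm // mul1r; congr (_ * _).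
  rewrite -powR_mulrn ?powR_ge0 // -powRrM -powRN; congr (_ `^ _).
  by field.
rewrite neq_lt => /orP[a0|/pos //].
have -> : @cbrt R = (fun x => - cbrt (- x)).
  by apply/funext => x; rewrite cbrtN opprK.
have := pos (- a); rewrite oppr_gt0 => /(_ a0) da.
have [dd dE] := da.
have dda : derivable (@cbrt R) (- a) 1 by [].
apply: DeriveDef.
  apply: derivableN; apply/derivable1_diffP.
  apply: (@differentiable_comp _ _ _ _ (fun x : R => - x) (@cbrt R)).
    exact/derivable1_diffP/derivable_opp.
  exact/derivable1_diffP.
have dc : derivable (@cbrt R \o -%R) a 1.
  apply/derivable1_diffP/differentiable_comp; last exact/derivable1_diffP.
  exact/derivable1_diffP/derivable_opp.
rewrite (deriveN dc) -derive1E derive1_comp;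
  [|exact: derivable_opp|exact: dda].
rewrite !derive1E dE deriveN ?derive_id; last exact: derivable_id.
by rewrite mulrN1 opprK cbrtN sqrrN opprK.
Unshelve. all: by end_near. Qed.

End CubeRoot.

Section PartialDerivatives.
Variables (R : realType) (n : nat).
Implicit Types (f g : 'rV[R]_n.+1 -> R) (w : 'rV[R]_n.+1) (O : set 'rV[R]_n.+1).

Lemma partial_coord (i j : 'I_n.+1) w :
  partial i (fun v => v 0 j) w = (i == j)%:R.
Proof.
have : 'D_(delta_mx 0 i) id w = delta_mx 0 i :> 'rV[R]_n.+1 by rewrite derive_id.
rewrite derive_mx; last exact: derivable_id.
by move=> /matrixP /(_ 0 j); rewrite !mxE eqxx /= eq_sym.
Qed.

Lemma partial_comp (i : 'I_n.+1) (phi : R -> R) f w :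
  differentiable f w -> derivable phi (f w) 1 ->
  partial i (phi \o f) w = derive1 phi (f w) * partial i f w.
Proof.
move=> df /derivable1_diffP dphi; rewrite /partial !deriveE //; last first.
  exact: differentiable_comp.
by rewrite diff_comp //= (diff1E dphi) mulrC.
Qed.

Lemma partial_near (i : 'I_n.+1) f g O w : open O -> O w ->
  (forall v, O v -> f v = g v) -> partial i f w = partial i g w.
Proof.
move=> oO Ow fg; apply: near_eq_derive.
by apply: filterS (open_nbhs_nbhs (conj oO Ow)) => v /fg.
Qed.

Definition diff_on O : set ('rV[R]_n.+1 -> R) :=
  [set f | forall w, O w -> differentiable f w].

Lemma function_ring_diff_on O : function_ring idfun (diff_on O).
Proof.
split=> [r w _|f g Sf Sg w Ow|f g Sf Sg w Ow].
- exact: differentiable_cst.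
- by apply: differentiableD; [exact: Sf|exact: Sg].
- by apply: differentiableM; [exact: Sf|exact: Sg].
Qed.

Lemma derivation_partial O (i : 'I_n.+1) : open O ->
  derivation idfun O (diff_on O) (partial i).
Proof.
move=> oO; split=> [r w _|f g Sf Sg w Ow|f g Sf Sg w Ow|f g fg w Ow].
- exact: derive_cst.
- by rewrite /partial deriveD //; apply: diff_derivable; [exact: Sf|exact: Sg].
- rewrite /partial deriveM; [|apply: diff_derivable; exact: Sf
    |apply: diff_derivable; exact: Sg].
  by rewrite addrC /GRing.scale /= mulrC.
- exact: (partial_near i oO Ow fg).
Qed.

End PartialDerivatives.

Section Jets.
Variables (R : realType) (U : set R) (F : R -> R).
Hypotheses (smoothF : smooth1_on U F)
  (F2_neq0 : forall q, U q -> derive1n 2 F q != 0).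

Definition jet_atom (p q t u : R) (k : nat) : R :=
  match k with
  | 0%N => t
  | 1%N => t^-1
  | 2%N => cbrt (derive1n 2 F q)
  | 3%N => (cbrt (derive1n 2 F q))^-1
  | 4%N => u
  | 5%N => p
  | 6%N => q
  | _ => derive1n (k - 7) F q
  end.

Variables (n : nat) (p q t u : 'rV[R]_n.+1 -> R) (O : set 'rV[R]_n.+1).
Hypotheses (dp : diff_on O p) (dq : diff_on O q) (dt : diff_on O t)
  (du : diff_on O u) (Uq : forall w, O w -> U (q w))
  (t_neq0 : forall w, O w -> t w != 0).

Definition jet_atoms (w : 'rV[R]_n.+1) := jet_atom (p w) (q w) (t w) (u w).

Lemma jet_atoms01 w : O w -> jet_atoms w 0 * jet_atoms w 1 = 1.
Proof. by move=> Ow; rewrite /jet_atoms /= divff ?t_neq0. Qed.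

Lemma jet_atoms23 w : O w -> jet_atoms w 2 * jet_atoms w 3 = 1.
Proof.
by move=> Ow; rewrite /jet_atoms /= divff // cbrt_neq0 // F2_neq0 //; exact: Uq.
Qed.

Lemma diff_jet k : diff_on O (derive1n k F \o q).
Proof.
move=> w Ow; apply: differentiable_comp; first exact: dq.
by apply/derivable1_diffP; apply: smoothF; exact: Uq.
Qed.

Lemma partial_jet i k w : O w ->
  partial i (derive1n k F \o q) w = derive1n k.+1 F (q w) * partial i q w.
Proof.
move=> Ow; rewrite partial_comp; [|exact: dq|by apply: smoothF; exact: Uq].
by rewrite derive1nS.
Qed.

Lemma diff_cbrt_jet : diff_on O (@cbrt R \o (derive1n 2 F \o q)).
Proof.
move=> w Ow; apply: differentiable_comp; first exact: diff_jet.
apply/derivable1_diffP.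
by have [] := is_derive_cbrt (F2_neq0 (Uq Ow)).
Qed.

Lemma partial_cbrt_jet i w : O w ->
  partial i (@cbrt R \o (derive1n 2 F \o q)) w =
  3^-1 * cbrt (derive1n 2 F (q w)) ^- 2 * (derive1n 3 F (q w) * partial i q w).
Proof.
move=> Ow; have [dc dcE] := is_derive_cbrt (F2_neq0 (Uq Ow)).
rewrite partial_comp; [|exact: diff_jet|exact: dc].
by rewrite partial_jet // derive1E dcE.
Qed.

Lemma diff_jet_atoms k : diff_on O (jet_atoms^~ k).
Proof.
move=> w Ow; case: k => [|[|[|[|[|[|[|k]]]]]]].
- exact: dt.
- by apply: differentiableV; [exact: dt|exact: t_neq0].
- exact: diff_cbrt_jet.
- apply: differentiableV; first exact: diff_cbrt_jet.
  by rewrite /= cbrt_neq0 // F2_neq0 //; exact: Uq.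
- exact: du.
- exact: dp.
- exact: dq.
- exact: diff_jet.
Qed.

(** The functions [p], [q], [t], [u] are only assumed to have the partial derivatives of
    coordinates, so one proof covers J with t = 1 and u = 0, J x R_+ with u = 0, and the full space:
    the coordinates missing there have an index that [i] cannot reach. *)
Lemma partial_jet_atoms (i : 'I_n.+1) k w : O w ->
  partial i p w = (i == 2 :> nat)%:R -> partial i q w = (i == 3 :> nat)%:R ->
  partial i t w = (i == 5 :> nat)%:R -> partial i u w = (i == 6 :> nat)%:R ->
  partial i (jet_atoms^~ k) w = peval idfun (jet_atoms w) (datom i k).
Proof.
move=> Ow ip iq it iu.
have pE := pevalE idfun (jet_atoms01 Ow) (jet_atoms23 Ow).
have V (f : 'rV[R]_n.+1 -> R) : differentiable f w -> f w != 0 ->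
    partial i (fun v => (f v)^-1) w = - (f w)^-1 ^+ 2 * partial i f w.
  move=> df f0; rewrite /partial deriveV //; last exact: diff_derivable.
  by rewrite /GRing.scale /= exprVn.
have f0 : cbrt (derive1n 2 F (q w)) != 0 by rewrite cbrt_neq0 // F2_neq0 //; exact: Uq.
have fd : differentiable (fun v => cbrt (derive1n 2 F (q v))) w := diff_cbrt_jet Ow.
have fE := partial_cbrt_jet i Ow.
case: k => [|[|[|[|[|[|[|k]]]]]]].
- rewrite [LHS]it.
  by case: (nat_of_ord i) => [|[|[|[|[|[|[|j]]]]]]]; rewrite /= ?pE.
- rewrite [LHS]V; [|exact: dt|exact: t_neq0]; rewrite it.
  by case: (nat_of_ord i) => [|[|[|[|[|[|[|j]]]]]]];
    rewrite /= ?pE ?mulr0n ?mulr1n ?mulr0 ?mulr1.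
- rewrite [LHS]fE iq.
  case: (nat_of_ord i) => [|[|[|[|[|[|[|j]]]]]]];
    rewrite /= ?pE ?mulr0n ?mulr1n ?mulr0 ?mulr1 //.
  by rewrite /jet_atoms /= exprVn; ring.
- rewrite [LHS]V // [partial _ _ _]fE iq.
  case: (nat_of_ord i) => [|[|[|[|[|[|[|j]]]]]]];
    rewrite /= ?pE ?mulr0n ?mulr1n ?mulr0 ?mulr1 //.
  by rewrite /jet_atoms /= -!exprVn; ring.
- rewrite [LHS]iu.
  by case: (nat_of_ord i) => [|[|[|[|[|[|[|j]]]]]]]; rewrite /= ?pE.
- rewrite [LHS]ip.
  by case: (nat_of_ord i) => [|[|[|[|[|[|[|j]]]]]]]; rewrite /= ?pE.
- rewrite [LHS]iq.
  by case: (nat_of_ord i) => [|[|[|[|[|[|[|j]]]]]]]; rewrite /= ?pE.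
- rewrite [LHS]partial_jet // iq.
  case: (nat_of_ord i) => [|[|[|[|[|[|[|j]]]]]]];
    rewrite /= ?pE ?mulr0n ?mulr1n ?mulr0 //.
  case: k => [|[|k]]; rewrite /= ?pE ?mulr1 //.
  by rewrite /jet_atoms /= cbrt_cube.
Qed.

End Jets.

(** * Evaluation of the metric *)

Lemma symprodE (R : realType) (n : nat) (b c : 'rV[R]_n) i j :
  symprod b c i j = 2^-1 * (b 0 i * c 0 j + c 0 i * b 0 j).
Proof. by rewrite /symprod !mxE !big_ord1 !mxE. Qed.

Lemma mx_entryE (R : realType) :
  (forall m n (b c : 'M[R]_(m, n)) i j, (b + c) i j = b i j + c i j) *
  (forall m n (b : 'M[R]_(m, n)) i j, (- b) i j = - b i j) *
  (forall m n r (b : 'M[R]_(m, n)) i j, (r *: b) i j = r * b i j).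
Proof. by do ![split]; move=> *; rewrite mxE. Qed.

Section MetricComponents.
Variables (R : realType) (F : R -> R) (v : 'rV[R]_5) (t u : R).
Hypotheses (t_neq0 : t != 0) (F2_neq0 : derive1n 2 F (v 0 3) != 0).

Let a := jet_atom F (v 0 2) (v 0 3) t u.
Let a01 : a 0 * a 1 = 1. Proof. exact: divff. Qed.
Let a23 : a 2 * a 3 = 1. Proof. by rewrite /a /= divff // cbrt_neq0. Qed.
Let pE := pevalE idfun a01 a23.

Let dE :
  (forall i, (delta_mx 0 0 : 'rV[R]_5) 0 i = peval idfun a (pdelta 0 i)) *
  (forall i, (delta_mx 0 1 : 'rV[R]_5) 0 i = peval idfun a (pdelta 1 i)) *
  (forall i, (delta_mx 0 2 : 'rV[R]_5) 0 i = peval idfun a (pdelta 2 i)) *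
  (forall i, (delta_mx 0 3 : 'rV[R]_5) 0 i = peval idfun a (pdelta 3 i)) *
  (forall i, (delta_mx 0 4 : 'rV[R]_5) 0 i = peval idfun a (pdelta 4 i)).
Proof.
by do ![split]; move=> *; rewrite !mxE eqxx peval_delta -!val_eqE.
Qed.

Let aE : (a 2 = cbrt (derive1n 2 F (v 0 3))) *
  (a 3 = (cbrt (derive1n 2 F (v 0 3)))^-1) * (a 5 = v 0 2) * (a 6 = v 0 3) *
  (a (7 + 0) = F (v 0 3)) * (a (7 + 1) = derive1n 1 F (v 0 3)) *
  (a (7 + 3) = derive1n 3 F (v 0 3)) * (a (7 + 4) = derive1n 4 F (v 0 3)).
Proof. by []. Qed.

Let f := cbrt (derive1n 2 F (v 0 3)).
Let F2E : derive1n 2 F (v 0 3) = f ^+ 3.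
Proof. by rewrite /f cbrt_cube. Qed.

Let idE (r : R) : (idfun : {rmorphism R -> R}) r = r.
Proof. by []. Qed.

Let f_neq0 : f != 0. Proof. exact: cbrt_neq0. Qed.

(** Turns derivatives, entries and evaluations into variables, so that [ring] and [field] meet a
    purely algebraic identity in which only f is known to be nonzero. *)
Ltac freeze := move: f_neq0; generalize f => ? ?;
  repeat match goal with
  | |- context [derive1n ?k F ?x] => generalize (derive1n k F x) => ?
  | |- context [peval ?c ?b ?p] => generalize (peval c b p) => ?
  | |- context [F ?x] => generalize (F x) => ?
  | |- context [v ?x ?y] => generalize (v x y) => ?
  end.

Lemma peval_theta1 (i : 'I_5) : peval idfun a (sym_theta1 i) = theta1 v 0 i.
Proof. by rewrite /theta1 /sym_theta1 !mx_entryE !dE !pE !aE. Qed.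

Lemma peval_contact (i : 'I_5) : peval idfun a (sym_contact i) =
  (delta_mx 0 2 - v 0 3 *: delta_mx 0 0 : 'rV[R]_5) 0 i.
Proof. by rewrite /sym_contact !mx_entryE !dE !pE. Qed.

Lemma peval_theta2 (i : 'I_5) : peval idfun a (sym_theta2 i) = theta2 F v 0 i.
Proof. by rewrite /theta2 /sym_theta2 /sym_contact !mx_entryE !dE !pE. Qed.

Lemma peval_theta4 (i : 'I_5) : peval idfun a (sym_theta4 i) = theta4 F v 0 i.
Proof.
rewrite /theta4 /sym_theta4 /sym_contact !mx_entryE !dE !pE !aE idE -/f F2E.
by freeze; field.
Qed.

Lemma peval_theta5 (i : 'I_5) : peval idfun a (sym_theta5 i) = theta5 F v 0 i.
Proof. by rewrite /theta5 /sym_theta5 !mx_entryE !dE !pE !aE -/f; freeze; ring. Qed.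

Lemma peval_P : peval idfun a sym_P = P_fun F (v 0 3).
Proof.
rewrite /P_fun /sym_P !pE !aE idE -/f F2E.
by freeze; field.
Qed.

Lemma peval_g (i j : 'I_5) : peval idfun a (sym_g i j) = g_metric F v i j.
Proof.
have s3 : (Num.sqrt 3 : R) ^+ 2 = 3 by rewrite sqr_sqrtr ?ler0n.
have s30 : (Num.sqrt 3 : R) != 0 by rewrite sqrtr_eq0 -ltNge ltr0n.
have := (peval_theta1, peval_theta2, peval_theta4, peval_theta5, peval_contact).
rewrite /sym_g.
move: sym_theta1 sym_theta2 sym_theta4 sym_theta5 sym_contact => e1 e2 e4 e5 e3 eE.
rewrite !pE !eE aE idE -/f /g_metric /theta3.
move: (theta1 v) (theta2 F v) (theta4 F v) (theta5 F v) => f1 f2 f4 f5.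
move: (delta_mx 0 2 - _ *: _) => f3.
rewrite !(symprodE, mx_entryE) -/f.
(* The irrational factor of theta^3 enters the metric only through its square. This is why the
   rational symbolic side uses the contact form dp - q dx in place of theta^3. *)
have -> : (4 * 3^-1 : R) = (2 / Num.sqrt 3) ^+ 2.
  by rewrite expr_div_n s3; ring.
by move: (f) (2 / _) (f1 0 _) (f1 0 _) (f2 0 _) (f2 0 _) (f3 0 _) (f3 0 _)
  (f4 0 _) (f4 0 _) (f5 0 _) (f5 0 _) => *; field.
Qed.

Definition mu1_metric (v : 'rV[R]_5) : 'M[R]_5 :=
  - (2 * cbrt (derive1n 2 F (v 0 3)) ^+ 4 * P_fun F (v 0 3)) *:
    symprod (delta_mx 0 3) (delta_mx 0 3).

Lemma peval_mu1 (i j : 'I_5) : peval idfun a (sym_mu1 i j) = mu1_metric v i j.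
Proof.
rewrite /sym_mu1; have := peval_P; move: sym_P => e eE.
rewrite !pE eE /mu1_metric !(symprodE, mx_entryE) !dE aE -/f.
by move: (P_fun F _); freeze => *; field.
Qed.

End MetricComponents.

(** * Locality of differentiability, open domains and pullback *)

Lemma near0_differentiable (R : realType) (V W : normedModType R) (h : V -> W) x :
  (\forall y \near x, h y = 0) -> differentiable h x.
Proof.
move=> h0; have hx : h x = 0 by exact: (nbhs_singleton h0).
have E : h \o shift x = cst (h x) + (\0 : {linear V -> W}) +o_ (0 : V) id.
  apply/eqaddoP => e e0; near=> y.
  rewrite /= [X in `|X|](_ : _ = 0); last first.
    rewrite !fctE /= hx /cst /= !addr0 subr0.
    by near: y; move: h0; rewrite (near_shift 0 x) subr0.
  by rewrite normr0 mulr_ge0 // ltW.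
have c0 : continuous (\0 : {linear V -> W}) by move=> z; exact: cvg_cst.
by apply/diff_locallyP; rewrite (diff_unique c0 E).
Unshelve. all: by end_near. Qed.

(** Write f = g + (f - g): the second summand vanishes near x and has differential zero. This is
    required because iterated partial derivatives are identified with polynomials only on the open
    domain. *)
Lemma near_eq_differentiable (R : realType) (V W : normedModType R)
    (f g : V -> W) x :
  (\forall y \near x, f y = g y) -> differentiable g x -> differentiable f x.
Proof.
move=> fg dg; have -> : f = g + (f - g) by apply/funext => y; rewrite addrC subrK.
apply: differentiableD; first exact: dg.
apply: near0_differentiable.
by apply: filterS fg => y fgy; rewrite /= fctE fgy subrr.
Qed.

Section Domains.
Variables (R : realType) (U : set R).
Hypothesis openU : open U.

Lemma open_coord (n : nat) (i : 'I_n.+1) (V : set R) :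
  open V -> open [set w : 'rV[R]_n.+1 | V (w 0 i)].
Proof.
move=> oV; apply: (@open_comp _ _ (fun w : 'rV[R]_n.+1 => w 0 i)) => // w _.
exact: coord_continuous.
Qed.

Lemma Jproj7E (w : 'rV[R]_7) :
  (Jproj7 w 0 0 = w 0 0) * (Jproj7 w 0 1 = w 0 1) * (Jproj7 w 0 2 = w 0 2) *
  (Jproj7 w 0 3 = w 0 3) * (Jproj7 w 0 4 = w 0 4).
Proof. by do ![split]; rewrite mxE; congr (w _ _); exact: val_inj. Qed.

Lemma Jproj6E (w : 'rV[R]_6) :
  (Jproj6 w 0 0 = w 0 0) * (Jproj6 w 0 1 = w 0 1) * (Jproj6 w 0 2 = w 0 2) *
  (Jproj6 w 0 3 = w 0 3) * (Jproj6 w 0 4 = w 0 4).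
Proof. by do ![split]; rewrite mxE; congr (w _ _); exact: val_inj. Qed.

Lemma open_Jset : open (Jset U).
Proof. exact: open_coord. Qed.

Lemma open_JRset : open (JRset U).
Proof.
have -> : JRset U = [set w : 'rV[R]_6 | U (w 0 3)] `&`
                    [set w | [set t | 0 < t] (w 0 5)].
  by apply/seteqP; split=> w; rewrite /JRset /Jset /= Jproj6E.
by apply: openI; apply: open_coord => //; exact: open_gt.
Qed.

Lemma open_JRRset : open (JRRset U).
Proof.
have -> : JRRset U = [set w : 'rV[R]_7 | U (w 0 3)] `&`
                    [set w | [set t | 0 < t] (w 0 5)].
  by apply/seteqP; split=> w; rewrite /JRRset /Jset /= Jproj7E.
by apply: openI; apply: open_coord => //; exact: open_gt.
Qed.

End Domains.

Definition vanishes_beyond_5 (s : nat -> nat -> spoly) :=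
  all (fun i => all (fun j => (4 < maxn i j)%N ==> nilp (s i j)) (iota 0 7))
    (iota 0 7).

Lemma pull_peval (R : realType) (a : nat -> R) (s : nat -> nat -> spoly)
    (b : 'M[R]_5) (i j : 'I_7) : vanishes_beyond_5 s ->
  (forall i j : 'I_5, peval idfun a (s i j) = b i j) ->
  pull b i j = peval idfun a (s i j).
Proof.
move=> s0 sb; have {}s0 (k l : 'I_7) : (4 < maxn k l)%N ->
    peval idfun a (s k l) = 0.
  move=> kl; move/allP: s0 => /(_ k).
  rewrite mem_iota ltn_ord => /(_ isT) /allP /(_ l).
  by rewrite mem_iota ltn_ord => /(_ isT) /implyP /(_ kl) /nilP ->.
rewrite /pull; case: (@split_ordP 5 2 i) => i' ->; last first.
  rewrite s0 ?leq_max ?leq_addr //.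
  case: (@split_ordP 5 2 j) => j' ->.
    by rewrite (block_mxEdl b 0 0 (0 : 'M[R]_2)) mxE.
  by rewrite (block_mxEdr b 0 0 (0 : 'M[R]_2)) mxE.
case: (@split_ordP 5 2 j) => j' ->.
  by rewrite (block_mxEul b 0 0 (0 : 'M[R]_2)) -sb.
by rewrite (block_mxEur b 0 0 (0 : 'M[R]_2)) mxE s0 // leq_max leq_addr orbT.
Qed.

Lemma sym_g_vanishes : vanishes_beyond_5 sym_g.
Proof. by vm_compute. Qed.

Lemma sym_mu1_vanishes : vanishes_beyond_5 sym_mu1.
Proof. by vm_compute. Qed.

Lemma pull_scale (R : realType) r (b : 'M[R]_5) : pull (r *: b) = r *: pull b.
Proof.
by have := scale_block_mx r b 0 0 (0 : 'M[R]_2); rewrite !scaler0 => /esym.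
Qed.

(** * Ricci flatness of the metric on J x R_+ x R *)

Section RealAmbientMetric.
Variables (R : realType) (U : set R) (F : R -> R).
Hypotheses (openU : open U) (smoothF : smooth1_on U F)
  (F2_neq0 : forall q, U q -> derive1n 2 F q != 0).

Definition atoms7 : 'rV[R]_7 -> nat -> R :=
  jet_atoms F (fun w : 'rV[R]_7 => w 0 2) (fun w : 'rV[R]_7 => w 0 3)
    (fun w : 'rV[R]_7 => w 0 5) (fun w : 'rV[R]_7 => w 0 6).

Let O := JRRset U.
Let Uq (w : 'rV[R]_7) : O w -> U (w 0 3).
Proof. by case; rewrite /Jset /= Jproj7E. Qed.
Let t_neq0 (w : 'rV[R]_7) : O w -> w 0 5 != 0.
Proof. by case=> _; rewrite lt0r => /andP[]. Qed.

Let a01 w : O w -> atoms7 w 0 * atoms7 w 1 = 1.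
Proof. exact: (jet_atoms01 _ _ _ _ t_neq0). Qed.
Let a23 w : O w -> atoms7 w 2 * atoms7 w 3 = 1.
Proof. exact: (jet_atoms23 F2_neq0 _ _ _ Uq). Qed.

Lemma gt_metricE i j (w : 'rV[R]_7) : JRRset U w ->
  gt_metric F w i j = peval idfun (atoms7 w) (sym_gt i j).
Proof.
move=> Ow; have pE := pevalE idfun (a01 Ow) (a23 Ow).
have v2 : Jproj7 w 0 2 = w 0 2 by rewrite Jproj7E.
have v3 : Jproj7 w 0 3 = w 0 3 by rewrite Jproj7E.
have F2 : derive1n 2 F (Jproj7 w 0 3) != 0 by rewrite v3 F2_neq0 //; exact: Uq.
have aE : atoms7 w = jet_atom F (Jproj7 w 0 2) (Jproj7 w 0 3) (w 0 5) (w 0 6).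
  by rewrite v2 v3.
have gE : pull (g_metric F (Jproj7 w)) i j = peval idfun (atoms7 w) (sym_g i j).
  by apply: pull_peval sym_g_vanishes _ => k l; rewrite aE peval_g // t_neq0.
have mE : pull (mu1_metric F (Jproj7 w)) i j =
    peval idfun (atoms7 w) (sym_mu1 i j).
  by apply: pull_peval sym_mu1_vanishes _ => k l; rewrite aE peval_mu1 // t_neq0.
rewrite /gt_metric /sym_gt !(symprodE, mx_entryE).
move: gE mE; rewrite pull_scale [(_ *: pull _) i j]mxE.
move: (pull _ i j) (pull _ i j) (sym_g i j) (sym_mu1 i j) => g m sg sm -> mE.
rewrite !pE -mE !peval_delta v3.
have -> : (dt R 0 i = (i == 5%N :> nat)%:R) by rewrite mxE.
have -> : (dt R 0 j = (j == 5%N :> nat)%:R) by rewrite mxE.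
have -> : (du R 0 i = (i == 6%N :> nat)%:R) by rewrite mxE.
have -> : (du R 0 j = (j == 6%N :> nat)%:R) by rewrite mxE.
have -> : atoms7 w 0 = w 0 5 by [].
have -> : atoms7 w 4 = w 0 6 by [].
move: (P_fun F _) (cbrt _) => *.
by field.
Qed.

Lemma ambient_ricci_flat i j (w : 'rV[R]_7) : JRRset U w ->
  ricci (@partial R 6) (gt_metric F) i j w = 0.
Proof.
have dcoord (k : 'I_7) : diff_on O (fun v : 'rV[R]_7 => v 0 k).
  by move=> v _; exact: differentiable_coord.
have oO : open O := open_JRRset openU.
move=> Ow; apply: (@sym_ricci_flatP R R idfun 'rV[R]_7 O (diff_on O) atoms7 _ _
  a01 a23 7 (@partial R 6) datom _ _ _ sym_gt sym_gt_inv _ _ _ _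
  sym_gt_inverse sym_gt_ricci_flat Ow).
- exact: function_ring_diff_on.
- by apply: (diff_jet_atoms smoothF F2_neq0 _ _ _ _ Uq t_neq0); exact: dcoord.
- by move=> k; exact: derivation_partial.
- move=> k l v Ov.
  apply: (partial_jet_atoms smoothF F2_neq0 _ _ Uq t_neq0) => //;
    by [exact: dcoord|rewrite partial_coord].
- by move=> k l v Ov; exact: gt_metricE.
Qed.

Lemma gt_metric_unit (w : 'rV[R]_7) : JRRset U w -> gt_metric F w \in unitmx.
Proof.
move=> Ow; have [] // := @sym_inverseP R R idfun 'rV[R]_7 O atoms7 a01 a23 7
  (gt_metric F) sym_gt sym_gt_inv _ w sym_gt_inverse Ow.
by move=> i j v Ov; exact: gt_metricE.
Qed.

End RealAmbientMetric.

(** * Smoothness and nondegeneracy on J *)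

Section Smoothness.
Variables (R : realType) (U : set R) (F : R -> R).
Hypotheses (openU : open U) (smoothF : smooth1_on U F)
  (F2_neq0 : forall q, U q -> derive1n 2 F q != 0).

(** J has no coordinates t and u; the constants 1 and 0 fill these slots, and t = 1 respects the
    relation between the first two atoms. *)
Definition atoms5 : 'rV[R]_5 -> nat -> R :=
  jet_atoms F (fun v : 'rV[R]_5 => v 0 2) (fun v : 'rV[R]_5 => v 0 3)
    (fun=> 1) (fun=> 0).

Let O := Jset U.
Let Uq (v : 'rV[R]_5) : O v -> U (v 0 3). Proof. by []. Qed.
Let t_neq0 (v : 'rV[R]_5) : O v -> (1 : R) != 0.
Proof. by rewrite oner_eq0. Qed.

Let a01 v : O v -> atoms5 v 0 * atoms5 v 1 = 1.
Proof. exact: (jet_atoms01 _ _ _ _ t_neq0). Qed.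
Let a23 v : O v -> atoms5 v 2 * atoms5 v 3 = 1.
Proof. exact: (jet_atoms23 F2_neq0 _ _ _ Uq). Qed.

Let dcoord (k : 'I_5) : diff_on O (fun v : 'rV[R]_5 => v 0 k).
Proof. by move=> v _; exact: differentiable_coord. Qed.
Let dcst (r : R) : diff_on O (fun=> r : R).
Proof. by move=> v _; exact: differentiable_cst. Qed.

Let diff_atom k : diff_on O (atoms5^~ k).
Proof.
by apply: (diff_jet_atoms smoothF F2_neq0 _ _ _ _ Uq t_neq0);
  solve [exact: dcoord|exact: dcst].
Qed.

Let partial_atom (i : 'I_5) k v : O v ->
  partial i (atoms5^~ k) v = peval idfun (atoms5 v) (datom i k).
Proof.
move=> Ov.
apply: (partial_jet_atoms smoothF F2_neq0 (dcoord _) (dcst _) Uq t_neq0) => //.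
- by rewrite partial_coord.
- by rewrite partial_coord.
- by rewrite [LHS]derive_cst; case: i => -[|[|[|[|[|]]]]].
- by rewrite [LHS]derive_cst; case: i => -[|[|[|[|[|]]]]].
Qed.

(** The evaluated polynomials are differentiable and closed under partial derivatives, so every
    iterated partial derivative of f is again one of them, namely the polynomial [es]. *)
Lemma smooth_on_peval f e :
  (forall v, Jset U v -> f v = peval idfun (atoms5 v) e) -> smooth_on (Jset U) f.
Proof.
move=> fe s w Ow; have oO : open O := open_Jset openU.
pose es := foldr (fun (i : 'I_5) e => pder (datom i) e) e s.
suff E v : O v -> foldr (@partial R 4) f s v = peval idfun (atoms5 v) es.
  apply: (@near_eq_differentiable _ _ _ _ (fun v => peval idfun (atoms5 v) es)).
    by apply: filterS (open_nbhs_nbhs (conj oO Ow)) => v /E.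
  by apply: (fring_peval (function_ring_diff_on O) diff_atom).
rewrite {}/es; elim: s v => [|i s IH] v Ov /=; first exact: fe.
rewrite (partial_near i oO Ov IH).
exact: (der_peval (function_ring_diff_on O) diff_atom a01 a23
  (derivation_partial i oO) (partial_atom i)).
Qed.

Lemma smooth_g_metric i j : smooth_on (Jset U) (fun v => g_metric F v i j).
Proof.
apply: (@smooth_on_peval _ (sym_g i j)) => v Ov.
by rewrite peval_g ?oner_eq0 // F2_neq0.
Qed.

Lemma smooth_mu1_metric i j : smooth_on (Jset U) (fun v => mu1_metric F v i j).
Proof.
apply: (@smooth_on_peval _ (sym_mu1 i j)) => v Ov.
by rewrite peval_mu1 ?oner_eq0 // F2_neq0.
Qed.

Lemma g_metric_unit (v : 'rV[R]_5) : Jset U v -> g_metric F v \in unitmx.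
Proof.
move=> Ov; have [] // := @sym_inverseP R R idfun 'rV[R]_5 O atoms5 a01 a23 5
  (g_metric F) sym_g sym_g_inv _ v sym_g_inverse Ov.
by move=> i j w Ow; rewrite peval_g ?oner_eq0 // F2_neq0.
Qed.

End Smoothness.

(** * Formal power series *)

Section FormalSeries.
Variable R : fieldType.
Implicit Types (a b : fps R) (r : R).

Definition fpsC r : fps R := Fps (fun k => if k is 0%N then r else 0).
Definition fpsX : fps R := Fps (fun k => (k == 1%N)%:R).

Lemma fcoefM a b k :
  fcoef (a * b) k = \sum_(i < k.+1) fcoef a i * fcoef b (k - i).
Proof. by []. Qed.

Lemma fcoef_sum (I : Type) (s : seq I) (P : pred I) (f : I -> fps R) k :
  fcoef (\sum_(i <- s | P i) f i) k = \sum_(i <- s | P i) fcoef (f i) k.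
Proof. by elim/big_rec2: _ => [//|i x y _ <-]. Qed.

Lemma fcoefCM r a k : fcoef (fpsC r * a) k = r * fcoef a k.
Proof.
rewrite fcoefM big_ord_recl subn0 big1 ?addr0 // => i _.
by rewrite /= mul0r.
Qed.

Lemma fcoef_affine r s k : fcoef (fpsC r + fpsC s * fpsX) k =
  (if k is 0%N then r else 0) + s * (k == 1%N)%:R.
Proof. by rewrite -[LHS]/(_ + fcoef (fpsC s * fpsX) k) fcoefCM. Qed.

Fact fpsC_zmod : zmod_morphism fpsC.
Proof. by move=> r s; apply: fpsP => -[|k] //=; rewrite subr0. Qed.

Fact fpsC_monoid : monoid_morphism fpsC.
Proof.
split=> [|r s]; apply: fpsP => -[|k] //.
by rewrite fcoefCM /= ?mulr0.
by rewrite fcoefCM /= ?mulr0.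
Qed.

HB.instance Definition _ := GRing.isZmodMorphism.Build R (fps R) fpsC fpsC_zmod.
HB.instance Definition _ :=
  GRing.isMonoidMorphism.Build R (fps R) fpsC fpsC_monoid.

Definition fps_const a : R := fcoef a 0.

Fact fps_const_zmod : zmod_morphism fps_const. Proof. by []. Qed.

Fact fps_const_monoid : monoid_morphism fps_const.
Proof. by split=> // a b; rewrite /fps_const fcoefM big_ord1. Qed.

HB.instance Definition _ :=
  GRing.isZmodMorphism.Build (fps R) R fps_const fps_const_zmod.
HB.instance Definition _ :=
  GRing.isMonoidMorphism.Build (fps R) R fps_const fps_const_monoid.

(** Solves b * a = 1 degree by degree. The whole list of earlier coefficients is returned because
    each new one depends on all of them. *)
Fixpoint inv_coefs a n : seq R :=
  if n is m.+1 then
    let s := inv_coefs a m in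
    rcons s ((fcoef a 0)^-1 *
      ((m == 0%N)%:R - \sum_(i < m) s`_i * fcoef a (m - i)))
  else [::].

Lemma fps_unitE a : fcoef a 0 != 0 -> a \is a GRing.unit.
Proof.
move=> a0; have sz n : size (inv_coefs a n) = n.
  by elim: n => //= n IH; rewrite size_rcons IH.
pose b := Fps (fun n => (inv_coefs a n.+1)`_n).
have stable n i : (i < n)%N -> (inv_coefs a n)`_i = fcoef b i.
  elim: n => // n IH; rewrite ltnS leq_eqVlt => /orP[/eqP -> //|lin].
  by rewrite [inv_coefs _ _]/= nth_rcons sz lin IH.
suff ba : b * a = 1 by apply/unitrP; exists b; rewrite [a * b]mulrC.
apply: fpsP => n; rewrite fcoefM big_ord_recr subnn.
have -> : fcoef b n = (fcoef a 0)^-1 *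
    ((n == 0%N)%:R - \sum_(i < n) fcoef b i * fcoef a (n - i)).
  rewrite /b [fcoef _ _]/= nth_rcons sz ltnn eqxx; congr (_ * (_ - _)).
  by apply: eq_bigr => i _; rewrite stable.
rewrite mulrAC mulVf // mul1r [LHS]addrC.
exact: subrK.
Qed.

Definition fps_deriv a : fps R := Fps (fun k => k.+1%:R * fcoef a k.+1).

Lemma fps_derivM a b :
  fps_deriv (a * b) = fps_deriv a * b + a * fps_deriv b.
Proof.
apply: fpsP => k.
rewrite -[LHS]/(k.+1%:R * fcoef (a * b) k.+1) fcoefM mulr_sumr.
(* The weight k + 1 is split as i + (k + 1 - i), one part for each factor. Afterwards the term i = 0
   drops out of the first sum and i = k + 1 out of the second. *)
transitivity (\sum_(i < k.+2) (i%:R * fcoef a i * fcoef b (k.+1 - i) +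
    fcoef a i * ((k.+1 - i)%:R * fcoef b (k.+1 - i)))).
  apply: eq_bigr => i _.
  rewrite -{1}(subnKC (ltn_ord i : (i <= k.+1)%N)) natrD; ring.
rewrite big_split [LHS]/= [X in _ = X](_ : _ = fcoef (fps_deriv a * b) k +
  fcoef (a * fps_deriv b) k) //; congr (_ + _).
  rewrite big_ord_recl mulr0n !mul0r add0r fcoefM; apply: eq_bigr => i _.
  by rewrite /= /bump add1n subSS.
rewrite big_ord_recr [LHS]/= subnn mul0r mulr0 addr0 fcoefM; apply: eq_bigr => i _.
by rewrite /= subSn // -ltnS.
Qed.

End FormalSeries.

Section FormalPartial.
Variable R : realType.
Implicit Types (f g : 'rV[R]_6 -> fps R) (w : 'rV[R]_6) (O : set 'rV[R]_6).

Lemma formal_partial_space (i : 'I_6) f w :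
  formal_partial (lshift 1 i) f w =
  Fps (fun k => partial i (fun v => fcoef (f v) k) w).
Proof. by rewrite /formal_partial (unsplitK (inl i)). Qed.

Lemma formal_partial_u (i : 'I_1) f w :
  formal_partial (rshift 6 i) f w = fps_deriv (f w).
Proof. by rewrite /formal_partial (unsplitK (inr i)). Qed.

Definition fdiff_on O : set ('rV[R]_6 -> fps R) :=
  [set f | forall k, diff_on O (fun v => fcoef (f v) k)].

Lemma fcoefM_fun f g k : (fun v => fcoef (f v * g v) k) =
  \sum_(i < k.+1) ((fun v => fcoef (f v) i) * (fun v => fcoef (g v) (k - i))).
Proof. by apply/funext => v; rewrite fcoefM fct_sumE. Qed.

Lemma function_ring_fdiff_on O : function_ring (@fpsC R) (fdiff_on O).
Proof.
split=> [r k w _|f g Sf Sg k w Ow|f g Sf Sg k w Ow].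
- exact: differentiable_cst.
- by apply: differentiableD; [exact: Sf|exact: Sg].
- rewrite fcoefM_fun; apply: differentiable_sum => i.
  by apply: differentiableM; [exact: Sf|exact: Sg].
Qed.

Lemma derivation_formal_partial O (i : 'I_7) : open O ->
  derivation (@fpsC R) O (fdiff_on O) (formal_partial i).
Proof.
move=> oO; case: (@split_ordP 6 1 i) => {}i ->; last first.
  split=> [r w _|f g _ _ w _|f g _ _ w _|f g fg w Ow];
    rewrite !formal_partial_u.
  - by apply: fpsP => k /=; rewrite mulr0.
  - by apply: fpsP => k /=; rewrite mulrDr.
  - exact: fps_derivM.
  - by rewrite fg.
split=> [r w _|f g Sf Sg w Ow|f g Sf Sg w Ow|f g fg w Ow];
  rewrite !formal_partial_space; apply: fpsP => k.
- exact: derive_cst.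
- by rewrite /= /partial deriveD //; apply: diff_derivable; [exact: Sf|exact: Sg].
- rewrite [LHS]/= fcoefM_fun /partial derive_sum; last first.
    move=> j; apply: derivableM; apply: diff_derivable;
      [exact: Sf|exact: Sg].
  rewrite [RHS](_ : _ = \sum_(j < k.+1)
    ('D_(delta_mx 0 i) (fun v => fcoef (f v) j) w * fcoef (g w) (k - j) +
     fcoef (f w) j * 'D_(delta_mx 0 i) (fun v => fcoef (g v) (k - j)) w)).
    apply: eq_bigr => j _; rewrite deriveM; [|apply: diff_derivable; exact: Sf
      |apply: diff_derivable; exact: Sg].
    by rewrite addrC /GRing.scale /= mulrC.
  by rewrite big_split.
- by apply: (partial_near i oO Ow) => v /fg ->.
Qed.

End FormalPartial.

(** * The ambient metric as a formal series in u *)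

Section FormalAmbientMetric.
Variables (R : realType) (U : set R) (F : R -> R).
Hypotheses (openU : open U) (smoothF : smooth1_on U F)
  (F2_neq0 : forall q, U q -> derive1n 2 F q != 0).

Definition base6 : 'rV[R]_6 -> nat -> R :=
  jet_atoms F (fun w : 'rV[R]_6 => w 0 2) (fun w : 'rV[R]_6 => w 0 3)
    (fun w : 'rV[R]_6 => w 0 5) (fun=> 0).

(** The coordinate u becomes the formal variable and all other atoms become constant series. The
    value 0 that [base6] has in the slot of u is a placeholder, overridden here. *)
Definition atoms6 (w : 'rV[R]_6) (k : nat) : fps R :=
  if k == 4%N then fpsX R else fpsC (base6 w k).

Definition ambient_coefs (k : nat) : 'rV[R]_5 -> 'M[R]_5 :=
  match k with
  | 0%N => g_metric F
  | 1%N => mu1_metric F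
  | _ => fun=> 0
  end.

Let O := JRset U.
Let oO : open O := open_JRset openU.
Let Uq (w : 'rV[R]_6) : O w -> U (w 0 3).
Proof. by case; rewrite /Jset /= Jproj6E. Qed.
Let t_neq0 (w : 'rV[R]_6) : O w -> w 0 5 != 0.
Proof. by case=> _; rewrite lt0r => /andP[]. Qed.

Let b01 w : O w -> base6 w 0 * base6 w 1 = 1.
Proof. exact: (jet_atoms01 _ _ _ _ t_neq0). Qed.
Let b23 w : O w -> base6 w 2 * base6 w 3 = 1.
Proof. exact: (jet_atoms23 F2_neq0 _ _ _ Uq). Qed.
Let a01 w : O w -> atoms6 w 0 * atoms6 w 1 = 1.
Proof. by move=> Ow; rewrite /atoms6 /= -rmorphM b01 // rmorph1. Qed.
Let a23 w : O w -> atoms6 w 2 * atoms6 w 3 = 1.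
Proof. by move=> Ow; rewrite /atoms6 /= -rmorphM b23 // rmorph1. Qed.

Lemma peval_atoms6 w p : pfree 4 p ->
  peval (@fpsC R) (atoms6 w) p = fpsC (peval idfun (base6 w) p).
Proof.
move=> p4.
rewrite -(@peval_rmorph R R (fps R) idfun (@fpsC R) (@fpsC R) (base6 w) p
  (fun=> erefl)).
by apply: eq_peval p4 _ => k /negPf k4; rewrite /atoms6 k4.
Qed.

Lemma peval_pull6 (s : nat -> nat -> spoly) (b : 'M[R]_5) w (i j : 'I_7) :
  vanishes_beyond_5 s -> pfree 4 (s i j) ->
  (forall k l : 'I_5, peval idfun (base6 w) (s k l) = b k l) ->
  peval (@fpsC R) (atoms6 w) (s i j) = fpsC (pull b i j).
Proof.
by move=> s0 sij sb; rewrite (peval_atoms6 _ sij) (pull_peval _ _ s0 sb).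
Qed.

Lemma pfree_datom i k : (i < 6)%N -> pfree 4 (datom i k).
Proof.
by case: i => [|[|[|[|[|[|//]]]]]] _; do 9?[case: k => [|k]//].
Qed.

Lemma pfree_sym_metric (i j : 'I_7) :
  pfree 4 (sym_g i j) && pfree 4 (sym_mu1 i j).
Proof.
have : all (fun i => all (fun j => pfree 4 (sym_g i j) && pfree 4 (sym_mu1 i j))
  (iota 0 7)) (iota 0 7) by vm_compute.
move=> /allP /(_ i); rewrite mem_iota ltn_ord => /(_ isT) /allP /(_ j).
by rewrite mem_iota ltn_ord => /(_ isT).
Qed.

Let dcoord (k : 'I_6) : diff_on O (fun v : 'rV[R]_6 => v 0 k).
Proof. by move=> v _; exact: differentiable_coord. Qed.
Let dcst (r : R) : diff_on O (fun=> r : R).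
Proof. by move=> v _; exact: differentiable_cst. Qed.

Let fdiff_atom k : fdiff_on O (atoms6^~ k).
Proof.
move=> j; rewrite /atoms6; case: eqP => _; first exact: dcst.
case: j => [|j]; last exact: dcst.
by apply: (diff_jet_atoms smoothF F2_neq0 _ _ _ _ Uq t_neq0);
  solve [exact: dcoord|exact: dcst].
Qed.

Let partial_base (i : 'I_6) k w : O w ->
  partial i (base6^~ k) w = peval idfun (base6 w) (datom i k).
Proof.
move=> Ow.
apply: (partial_jet_atoms smoothF F2_neq0 (dcoord _) (dcoord _) Uq t_neq0) => //;
  rewrite ?partial_coord //.
by rewrite [LHS]derive_cst; case: i => -[|[|[|[|[|[|]]]]]].
Qed.

Let formal_partial_atom (i : 'I_7) k w : O w ->
  formal_partial i (atoms6^~ k) w = peval (@fpsC R) (atoms6 w) (datom i k).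
Proof.
move=> Ow; case: (@split_ordP 6 1 i) => {}i ->.
  rewrite formal_partial_space peval_atoms6; last exact: pfree_datom (ltn_ord i).
  apply: fpsP => j; rewrite [LHS]/= -partial_base //.
  have [->|/negPf k4] := eqVneq k 4%N.
    rewrite /atoms6 /= [LHS]derive_cst; case: j => [|//].
    by rewrite [RHS]/= [RHS]derive_cst.
  by rewrite /atoms6 k4; case: j => [//|j]; rewrite [LHS]derive_cst.
rewrite formal_partial_u ord1 /= /atoms6.
case: eqP => _.
  by rewrite peval_nat; apply: fpsP => -[|j] /=; rewrite ?mulr1 ?mulr0.
by apply: fpsP => j; rewrite /= mulr0.
Qed.

Lemma FG_series_affine i j (w : 'rV[R]_6) :
  FG_series ambient_coefs w i j =
  fpsC (w 0 5 ^+ 2 * pull (g_metric F (Jproj6 w)) i j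
        - 2 * symprod (dt R) (du R) i j)
  + fpsC (w 0 5 * pull (mu1_metric F (Jproj6 w)) i j) * fpsX R.
Proof.
rewrite mxE; apply: fpsP => k; rewrite [LHS]/= fcoef_affine.
case: k => [|[|k]]; rewrite !mx_entryE ?mulr0 ?mulr1 ?addr0.
- by rewrite addrC mulNr.
- by rewrite mxE !add0r.
- by rewrite mxE add0r /pull block_mx_const mxE mulr0.
Qed.

Lemma symprod_dt_du (i j : 'I_7) : 2 * symprod (dt R) (du R) i j =
  (i == 5%N :> nat)%:R * (j == 6%N :> nat)%:R
  + (i == 6%N :> nat)%:R * (j == 5%N :> nat)%:R.
Proof. by rewrite symprodE !mxE /= -!val_eqE /=; field. Qed.

Lemma FG_series_ambient i j (w : 'rV[R]_6) : JRset U w ->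
  FG_series ambient_coefs w i j = peval (@fpsC R) (atoms6 w) (sym_gt i j).
Proof.
move=> Ow; have pE := pevalE (@fpsC R) (a01 Ow) (a23 Ow).
have v2 : Jproj6 w 0 2 = w 0 2 by rewrite Jproj6E.
have v3 : Jproj6 w 0 3 = w 0 3 by rewrite Jproj6E.
have F2 : derive1n 2 F (Jproj6 w 0 3) != 0 by rewrite v3 F2_neq0 //; exact: Uq.
have aE : base6 w = jet_atom F (Jproj6 w 0 2) (Jproj6 w 0 3) (w 0 5) 0.
  by rewrite v2 v3.
have /andP[free_g free_m] := pfree_sym_metric i j.
have gE : peval (@fpsC R) (atoms6 w) (sym_g i j) =
    fpsC (pull (g_metric F (Jproj6 w)) i j).
  apply: (@peval_pull6 sym_g _ w i j sym_g_vanishes free_g) => k l.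
  by rewrite aE; apply: peval_g; [exact: t_neq0|exact: F2].
have mE : peval (@fpsC R) (atoms6 w) (sym_mu1 i j) =
    fpsC (pull (mu1_metric F (Jproj6 w)) i j).
  apply: peval_pull6 sym_mu1_vanishes free_m _ => k l.
  by rewrite aE peval_mu1 // t_neq0.
rewrite /sym_gt; move: gE mE.
move: (sym_g i j) (sym_mu1 i j) => sg sm gE mE.
rewrite !pE gE mE !peval_delta.
have -> : atoms6 w 0 = fpsC (w 0 5) by [].
have -> : atoms6 w 4 = fpsX R by [].
rewrite FG_series_affine symprod_dt_du.
by rewrite rmorphB rmorphD !rmorphM !rmorph_nat; ring.
Qed.

(** The computation that proves flatness of the genuine metric is reused here under the valuation
    [atoms6]. *)
Lemma ambient_formal_ricci_flat : FG_ricci_flat U ambient_coefs.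
Proof.
move=> w Ow i j.
apply: (@sym_ricci_flatP R (fps R) (@fpsC R) 'rV[R]_6 O (fdiff_on O) atoms6 _ _
  a01 a23 7 (@formal_partial R) datom _ _ _ sym_gt sym_gt_inv _ _ _ _
  sym_gt_inverse sym_gt_ricci_flat Ow).
- exact: function_ring_fdiff_on.
- exact: fdiff_atom.
- by move=> k; exact: derivation_formal_partial.
- exact: formal_partial_atom.
- exact: FG_series_ambient.
Qed.

Lemma ambient_coefs_FG : FG_coefficients U (g_metric F) ambient_coefs.
Proof.
split=> // -[|[|k]]; split.
- move=> v _; rewrite /= /g_metric.
  move: (theta1 v) (theta2 F v) (theta3 F v) (theta4 F v) (theta5 F v).
  move=> f1 f2 f3 f4 f5; apply/matrixP => i j.
  by rewrite mxE !(symprodE, mx_entryE); ring.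
- exact: smooth_g_metric.
- move=> v _; apply/matrixP => i j.
  by rewrite mxE !(symprodE, mx_entryE); ring.
- exact: smooth_mu1_metric.
- by move=> v _; rewrite /= trmx0.
- move=> i j; apply: (smooth_on_peval openU smoothF F2_neq0 (e := [::])) => v _.
  by rewrite mxE.
Qed.

Lemma ambient_sum : sum_of_series U (FG_series ambient_coefs) (gt_metric F).
Proof.
move=> w Ow i j; rewrite FG_series_affine.
have -> : Jproj6 (proj76 w) = Jproj7 w.
  by apply/rowP => k; rewrite !mxE; congr (w _ _); exact: val_inj.
have -> : proj76 w 0 5 = w 0 5 by rewrite mxE; congr (w _ _); exact: val_inj.
set b := (X in fpsC X + _); set c := (X in fpsC X * _).
have -> : gt_metric F w i j = b + c * w 0 6.
  rewrite /b /c /gt_metric /mu1_metric.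
  rewrite (pull_scale _ (symprod (delta_mx 0 3) (delta_mx 0 3))).
  rewrite !(symprodE, mx_entryE).
  by move: (P_fun F _) (cbrt _) => *; ring.
have fE := fcoef_affine b c; move: (fpsC b + _) fE => f fE.
apply: (@cvg_near_cst _ _ _ _ \oo).
(* The series is affine in u, so its partial sums are stationary from the second on. *)
exists 2%N => // n /= n2; rewrite /series /= (big_cat_nat _ n2) //=.
rewrite big_nat_recl // big_nat1 [X in _ + X]big_nat_cond big1 ?addr0.
  by rewrite !fE /=; ring.
move=> k /andP[/andP[k2 _] _]; rewrite fE.
by case: k k2 => [|[|k]] // _; rewrite mulr0 addr0 mul0r.
Qed.

End FormalAmbientMetric.

(** * Signature *)

Section Signature.
Variable R : realType.

(** With the forms as rows of T, the hypothesis reads b = T^T eta T. Invertibility of b then forces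
    that of T, so the independence of the forms comes for free and the inverse of T is the required
    basis. *)
Lemma has_signature_coframe (r s : nat) (b : 'M[R]_(r + s))
    (ps : r.-tuple 'rV[R]_(r + s)) (ns : s.-tuple 'rV[R]_(r + s)) :
  b \in unitmx ->
  (forall i j, b i j = \sum_(a <- ps) a 0 i * a 0 j
                       - \sum_(a <- ns) a 0 i * a 0 j) ->
  has_signature r s b.
Proof.
move=> b_unit bE; set eta : 'M[R]_(r + s) := block_mx 1%:M 0 0 (- 1%:M).
pose P : 'M[R]_(r, r + s) := \matrix_k tnth ps k.
pose N : 'M[R]_(s, r + s) := \matrix_k tnth ns k.
pose T : 'M[R]_(r + s) := col_mx P N.
have TE : T^T *m eta *m T = b.
  rewrite /T tr_col_mx mul_row_block !mulmx0 addr0 add0r mulmx1 mulmxN mulmx1.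
  rewrite mul_row_col mulNmx; apply/matrixP => i j.
  rewrite bE !big_tuple !mxE; congr (_ - _);
    by apply: eq_bigr => k _; rewrite !mxE.
have Tu : T \in unitmx.
  move: b_unit; rewrite -TE !unitmxE !det_mulmx det_tr unitrM.
  by case/andP.
exists (invmx T); first by rewrite unitmx_inv.
rewrite -TE !mulmxA trmx_inv.
by rewrite mulVmx ?unitmx_tr // mul1mx -mulmxA mulmxV // mulmx1.
Qed.

Let c : R := (Num.sqrt 2)^-1.
Let c2 : c * c = 2^-1.
Proof. by rewrite -invfM -expr2 sqr_sqrtr // ler0n. Qed.

(** The product 2 a b is the difference of the squares of (a + b) / sqrt 2 and (a - b) / sqrt 2, so
    a null pair yields one positive and one negative square whatever its sign. *)
Lemma null_coframe_signature5 (l1 l5 l2 l4 l3 : 'rV[R]_5) (b : 'M[R]_5) :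
  b \in unitmx ->
  b = 2 *: symprod l1 l5 - 2 *: symprod l2 l4 + symprod l3 l3 ->
  has_signature 3 2 b.
Proof.
move=> bu bE; apply: (@has_signature_coframe 3 2 b
  [tuple c *: (l1 + l5); c *: (l2 - l4); l3]
  [tuple c *: (l1 - l5); c *: (l2 + l4)] bu) => i j.
rewrite bE !big_cons !big_nil !(symprodE, mx_entryE).
transitivity ((c * c) * (2 * (l1 0 i * l5 0 j + l5 0 i * l1 0 j)
  - 2 * (l2 0 i * l4 0 j + l4 0 i * l2 0 j)) + l3 0 i * l3 0 j).
  by rewrite c2; field.
by ring.
Qed.

Lemma null_coframe_signature7 (l1 l5 l2 l4 l3 d1 d2 : 'rV[R]_7) (b : 'M[R]_7) :
  b \in unitmx ->
  b = 2 *: symprod l1 l5 - 2 *: symprod l2 l4 + symprod l3 l3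
      - 2 *: symprod d1 d2 ->
  has_signature 4 3 b.
Proof.
move=> bu bE; apply: (@has_signature_coframe 4 3 b
  [tuple c *: (l1 + l5); c *: (l2 - l4); l3; c *: (d1 - d2)]
  [tuple c *: (l1 - l5); c *: (l2 + l4); c *: (d1 + d2)] bu) => i j.
rewrite bE !big_cons !big_nil !(symprodE, mx_entryE).
transitivity ((c * c) * (2 * (l1 0 i * l5 0 j + l5 0 i * l1 0 j)
  - 2 * (l2 0 i * l4 0 j + l4 0 i * l2 0 j)
  - 2 * (d1 0 i * d2 0 j + d2 0 i * d1 0 j)) + l3 0 i * l3 0 j).
  by rewrite c2; field.
by ring.
Qed.

Lemma pull_add (a b : 'M[R]_5) : pull (a + b) = pull a + pull b.
Proof.
by have := add_block_mx a 0 0 (0 : 'M[R]_2) b 0 0 0; rewrite !addr0 => /esym.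
Qed.

Definition pull_form (a : 'rV[R]_5) : 'rV[R]_7 := row_mx a (0 : 'rV[R]_2).

Lemma pull_symprod (a b : 'rV[R]_5) :
  pull (symprod a b) = symprod (pull_form a) (pull_form b).
Proof.
have formEl (d : 'rV[R]_5) (k : 'I_5) :
    pull_form d 0 (lshift 2 k : 'I_7) = d 0 k.
  exact: row_mxEl.
have formEr (d : 'rV[R]_5) (k : 'I_2) : pull_form d 0 (rshift 5 k : 'I_7) = 0.
  by rewrite [LHS]row_mxEr mxE.
apply/matrixP => i j; rewrite symprodE /pull.
case: (@split_ordP 5 2 i) => i' ->; case: (@split_ordP 5 2 j) => j' ->.
- by rewrite !formEl [LHS]block_mxEul symprodE.
- by rewrite !formEl !formEr [LHS]block_mxEur mxE !(mulr0, mul0r, addr0).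
- by rewrite !formEl !formEr [LHS]block_mxEdl mxE !(mulr0, mul0r, addr0).
- by rewrite !formEr [LHS]block_mxEdr mxE !(mulr0, mul0r, addr0).
Qed.

Variables (U : set R) (F : R -> R).
Hypotheses (openU : open U) (smoothF : smooth1_on U F)
  (F2_neq0 : forall q, U q -> derive1n 2 F q != 0).

Lemma g_metric_signature (v : 'rV[R]_5) :
  Jset U v -> has_signature 3 2 (g_metric F v).
Proof.
move=> Uv; apply: null_coframe_signature5; last exact: erefl.
exact: g_metric_unit Uv.
Qed.

Lemma gt_metric_signature (w : 'rV[R]_7) :
  JRRset U w -> has_signature 4 3 (gt_metric F w).
Proof.
move=> Uw; set v := Jproj7 w; pose t := w 0 5; pose u := w 0 6.
pose l5 := pull_form (theta5 F v).
(* Since f^4 dq^2 = (theta^5)^2, the term in u is absorbed into the first null pair: 2 t^2 theta^1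
   theta^5 - 2 t u P (theta^5)^2 = 2 (t theta^1 - u P theta^5) (t theta^5). *)
apply: (@null_coframe_signature7
  (t *: pull_form (theta1 v) - (u * P_fun F (v 0 3)) *: l5) (t *: l5)
  (t *: pull_form (theta2 F v)) (t *: pull_form (theta4 F v))
  (t *: pull_form (theta3 F v)) (dt R) (du R)).
  exact: gt_metric_unit Uw.
have dq2 : cbrt (derive1n 2 F (v 0 3)) ^+ 4 *:
    pull (symprod (delta_mx 0 3) (delta_mx 0 3)) = symprod l5 l5.
  rewrite -pull_symprod -pull_scale; congr pull; rewrite /theta5.
  apply/matrixP => i j; rewrite !(symprodE, mx_entryE); ring.
apply/matrixP => i j; rewrite /gt_metric -/v -/t -/u.
have -> : 2 * t * u * cbrt (derive1n 2 F (v 0 3)) ^+ 4 * P_fun F (v 0 3) =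
   2 * t * u * P_fun F (v 0 3) * cbrt (derive1n 2 F (v 0 3)) ^+ 4 by ring.
rewrite -scalerA dq2 /g_metric -[- (2 *: symprod (theta2 F v) _)]scaleNr.
rewrite !pull_add !(pull_scale _ (symprod _ _)) !pull_symprod -/l5.
move: (pull_form (theta1 v)) (pull_form (theta2 F v)) (pull_form (theta3 F v))
  (pull_form (theta4 F v)) l5 (P_fun F _) {dq2} => l1 l2 l3 l4 l5 P.
by rewrite !(symprodE, mx_entryE); field.
Qed.

End Signature.

(** * Uniqueness of the ambient metric *)

Section BlockMetric.
Variables (A : comUnitRingType) (X : Type) (O : set X) (n : nat).
Variables (D : 'I_(n + 2) -> (X -> A) -> X -> A) (H : X -> 'M[A]_n).
Hypothesis D_cst : forall i (b : A) w, b = 0 \/ b = -1 -> O w -> D i (fun=> b) w = 0.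
Hypothesis D_local : forall i f g, (forall w, O w -> f w = g w) ->
  forall w, O w -> D i f w = D i g w.
Hypothesis H_unit : forall w, O w -> H w \in unitmx.

Let J (i : 'I_n) : 'I_(n + 2) := lshift 2 i.
Let e (a : 'I_2) : 'I_(n + 2) := rshift n a.

(** Gram matrix of -2 dt du. It is its own inverse, so raising a null index exchanges the two null
    directions, whence [rev_ord] below. Its entries 0 and -1 are the constants that [D_cst] speaks
    of. *)
Definition swap2 : 'M[A]_2 := \matrix_(a, b) - (a != b)%:R.

Definition block_metric (w : X) : 'M[A]_(n + 2) := block_mx (H w) 0 0 swap2.

Let G := block_metric.

Lemma swap2K : swap2 *m swap2 = 1%:M.
Proof.
apply/matrixP => a b; rewrite !mxE !big_ord_recl big_ord0 !mxE.
by case: a b => -[|[|//]] ? [[|[|//]] ?]; rewrite /=; ring.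
Qed.

Lemma invmx_block_metric w : O w ->
  invmx (G w) = block_mx (invmx (H w)) 0 0 swap2.
Proof.
move=> Ow; set I := block_mx _ _ _ _.
have GI : G w *m I = 1%:M.
  rewrite mulmx_block !mulmx0 !mul0mx !addr0 add0r mulmxV ?H_unit // swap2K.
  exact: esym (scalar_mx_block _ _ _).
have [Gu _] := mulmx1_unit GI.
by rewrite -[LHS]mulmx1 -GI mulmxA mulVmx // mul1mx.
Qed.

Let GJJ i j : (fun v => G v (J i) (J j)) = (fun v => H v i j).
Proof. by apply/funext => v; rewrite [LHS]block_mxEul. Qed.
Let GJe i a : (fun v => G v (J i) (e a)) = (fun=> 0).
Proof. by apply/funext => v; rewrite [LHS]block_mxEur mxE. Qed.
Let GeJ i a : (fun v => G v (e a) (J i)) = (fun=> 0).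
Proof. by apply/funext => v; rewrite [LHS]block_mxEdl mxE. Qed.
Let Gee a b : (fun v => G v (e a) (e b)) = (fun=> swap2 a b).
Proof. by apply/funext => v; rewrite [LHS]block_mxEdr. Qed.

Let D0 i w : O w -> D i (fun=> 0) w = 0.
Proof. by move=> Ow; rewrite D_cst //; left. Qed.
Let Dswap i a b w : O w -> D i (fun=> swap2 a b) w = 0.
Proof.
move=> Ow; rewrite D_cst // mxE; case: eqP => _; first by left; rewrite oppr0.
by right.
Qed.

Local Notation Gam := (christoffel D G).

Let GamE k i j w : O w -> Gam k i j w = 2^-1 *
  (\sum_(l < n) (block_mx (invmx (H w)) 0 0 swap2) k (J l) *
    (D i (fun v => G v j (J l)) w + D j (fun v => G v i (J l)) w
     - D (J l) (fun v => G v i j) w) +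
   \sum_(l < 2) (block_mx (invmx (H w)) 0 0 swap2) k (e l) *
    (D i (fun v => G v j (e l)) w + D j (fun v => G v i (e l)) w
     - D (e l) (fun v => G v i j) w)).
Proof. by move=> Ow; rewrite /christoffel invmx_block_metric // big_split_ord. Qed.

(* [christoffel_JJe]: this is Gam^k_(i a) for the block metric; likewise
   [half_deriv] gives Gam^a_(i j), up to exchanging the two null coordinates. *)
Definition mixed_christoffel (a : 'I_2) (k i : 'I_n) (w : X) : A :=
  2^-1 * \sum_l invmx (H w) k l * D (rshift n a) (fun v => H v i l) w.

Definition half_deriv (a : 'I_2) (i j : 'I_n) (w : X) : A :=
  2^-1 * D (rshift n a) (fun v => H v i j) w.

Lemma christoffel_JJJ k i j w : O w ->
  Gam (J k) (J i) (J j) w = christoffel (fun i => D (lshift 2 i)) H k i j w.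
Proof.
move=> Ow; rewrite GamE // [X in _ + X]big1 ?addr0; last first.
  by move=> l _; rewrite [X in X * _]block_mxEur mxE mul0r.
by congr (_ * _); apply: eq_bigr => l _; rewrite [X in X * _]block_mxEul !GJJ.
Qed.

Lemma christoffel_JJe k i a w : O w ->
  Gam (J k) (J i) (e a) w = mixed_christoffel a k i w.
Proof.
move=> Ow; rewrite GamE // [X in _ + X]big1 ?addr0; last first.
  by move=> l _; rewrite [X in X * _]block_mxEur mxE mul0r.
congr (_ * _); apply: eq_bigr => l _; rewrite [X in X * _]block_mxEul.
by rewrite GJJ GeJ GJe !D0 // add0r subr0.
Qed.

Lemma christoffel_JeJ k i a w : O w ->
  Gam (J k) (e a) (J i) w = mixed_christoffel a k i w.
Proof.
move=> Ow; rewrite -christoffel_JJe // !GamE //.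
congr (_ * (_ + _)); apply: eq_bigr => l _;
  by rewrite !(GJJ, GJe, GeJ, Gee) ?Dswap ?D0 // [X in _ * (X - _)]addrC.
Qed.

Lemma christoffel_Jee k a b w : O w -> Gam (J k) (e a) (e b) w = 0.
Proof.
move=> Ow; rewrite GamE // [X in X + _]big1 ?add0r ?[X in _ * X]big1 ?mulr0 //.
  by move=> l _; rewrite [X in X * _]block_mxEur mxE mul0r.
move=> l _; rewrite !GeJ Gee !D0 // Dswap // subr0 addr0 mulr0 //.
Qed.

Lemma christoffel_eJJ a i j w : O w ->
  Gam (e a) (J i) (J j) w = half_deriv (rev_ord a) i j w.
Proof.
move=> Ow; rewrite GamE // [X in X + _]big1 ?add0r; last first.
  by move=> l _; rewrite [X in X * _]block_mxEdl mxE mul0r.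
congr (_ * _).
transitivity (\sum_(l < 2) (a != l)%:R * D (e l) (fun v => H v i j) w).
  apply: eq_bigr => l _; rewrite [X in X * _]block_mxEdr mxE.
  by rewrite !GJe GJJ !D0 // add0r sub0r mulrNN.
rewrite !big_ord_recl big_ord0 /=.
case: a => -[|[|//]] ?; rewrite /= ?mul0r ?mul1r ?addr0 ?add0r;
  by congr (D (e _) _ _); apply: val_inj.
Qed.

Lemma christoffel_eJe a i b w : O w -> Gam (e a) (J i) (e b) w = 0.
Proof.
move=> Ow; rewrite GamE // [X in X + _]big1 ?add0r ?[X in _ * X]big1 ?mulr0 //.
  by move=> l _; rewrite !(GJJ, GJe, GeJ, Gee) ?Dswap ?D0 // subr0 addr0 mulr0.
by move=> l _; rewrite [X in X * _]block_mxEdl mxE mul0r.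
Qed.

Lemma christoffel_eeJ a i b w : O w -> Gam (e a) (e b) (J i) w = 0.
Proof.
move=> Ow; rewrite GamE // [X in X + _]big1 ?add0r ?[X in _ * X]big1 ?mulr0 //.
  by move=> l _; rewrite !(GJJ, GJe, GeJ, Gee) ?Dswap ?D0 // subr0 addr0 mulr0.
by move=> l _; rewrite [X in X * _]block_mxEdl mxE mul0r.
Qed.

Lemma christoffel_eee a b c w : O w -> Gam (e a) (e b) (e c) w = 0.
Proof.
move=> Ow; rewrite GamE // [X in X + _]big1 ?add0r ?[X in _ * X]big1 ?mulr0 //.
  by move=> l _; rewrite !(GJJ, GJe, GeJ, Gee) ?Dswap ?D0 // subr0 addr0 mulr0.
by move=> l _; rewrite [X in X * _]block_mxEdl mxE mul0r.
Qed.

Let D_ext i f g w : O w -> (forall v, O v -> f v = g v) -> D i f w = D i g w.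
Proof. by move=> Ow fg; exact: D_local. Qed.

(** Every correction to the Ricci tensor of H contains one derivative in each null direction,
    because the inverse of the null block is off-diagonal. Hence the equation is of first order in
    u. *)
Lemma ricci_block_JJ i j w : O w ->
  ricci D G (J i) (J j) w = ricci (fun i => D (lshift 2 i)) H i j w
  + D (e 0) (half_deriv 1 i j) w + D (e 1) (half_deriv 0 i j) w
  + \sum_k (mixed_christoffel 0 k k w * half_deriv 1 i j w
    + mixed_christoffel 1 k k w * half_deriv 0 i j w
    - mixed_christoffel 0 k j w * half_deriv 1 i k w
    - mixed_christoffel 1 k j w * half_deriv 0 i k w
    - mixed_christoffel 0 k i w * half_deriv 1 j k w
    - mixed_christoffel 1 k i w * half_deriv 0 j k w).
Proof.
move=> Ow; set gam := christoffel (fun i => D (lshift 2 i)) H.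
have D_JJJ p k' i' j' : D p (Gam (J k') (J i') (J j')) w = D p (gam k' i' j') w.
  by apply: D_ext => // v Ov; rewrite christoffel_JJJ.
have sum2 (f : 'I_2 -> A) : \sum_a f a = f 0 + f 1.
  by rewrite !big_ord_recl big_ord0 addr0; congr (_ + f _); apply: val_inj.
have rev0 : rev_ord (0 : 'I_2) = 1 by apply: val_inj.
have rev1 : rev_ord (1 : 'I_2) = 0 by apply: val_inj.
(* The contracted index of the Ricci tensor lies in the H-block here and in the null block in
   [partE]. *)
have partJ k :
    D (J k) (Gam (J k) (J i) (J j)) w - D (J j) (Gam (J k) (J i) (J k)) w
    + \sum_l (Gam (J k) (J k) l w * Gam l (J i) (J j) w
               - Gam (J k) (J j) l w * Gam l (J i) (J k) w) =
    (D (J k) (gam k i j) w - D (J j) (gam k i k) w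
     + \sum_l (gam k k l w * gam l i j w - gam k j l w * gam l i k w))
    + (mixed_christoffel 0 k k w * half_deriv 1 i j w
       + mixed_christoffel 1 k k w * half_deriv 0 i j w
       - mixed_christoffel 0 k j w * half_deriv 1 i k w
       - mixed_christoffel 1 k j w * half_deriv 0 i k w).
  rewrite !D_JJJ big_split_ord -[RHS]addrA; congr (_ + (_ + _)).
    by apply: eq_bigr => l _; rewrite !christoffel_JJJ.
  rewrite sum2 !christoffel_JJe // !christoffel_eJJ // rev0 rev1.
  by ring.
have partE a :
    D (e a) (Gam (e a) (J i) (J j)) w - D (J j) (Gam (e a) (J i) (e a)) w
    + \sum_l (Gam (e a) (e a) l w * Gam l (J i) (J j) w
               - Gam (e a) (J j) l w * Gam l (J i) (e a) w) =
    D (e a) (half_deriv (rev_ord a) i j) w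
    - \sum_l half_deriv (rev_ord a) j l w * mixed_christoffel a l i w.
  rewrite (D_ext _ Ow (fun v Ov => christoffel_eJJ a i j Ov)).
  rewrite (D_ext _ Ow (fun v Ov => christoffel_eJe a i a Ov)) D0 // subr0.
  congr (_ + _); rewrite big_split_ord /= [X in _ + X]big1 ?addr0; last first.
    by move=> l _; rewrite christoffel_eee // christoffel_eJe // !mul0r subr0.
  rewrite -sumrN; apply: eq_bigr => l _.
  by rewrite christoffel_eeJ // christoffel_eJJ // christoffel_JJe // mul0r sub0r.
have -> : ricci D G (J i) (J j) w = \sum_k (
    (D (J k) (gam k i j) w - D (J j) (gam k i k) w
     + \sum_l (gam k k l w * gam l i j w - gam k j l w * gam l i k w))
    + (mixed_christoffel 0 k k w * half_deriv 1 i j w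
       + mixed_christoffel 1 k k w * half_deriv 0 i j w
       - mixed_christoffel 0 k j w * half_deriv 1 i k w
       - mixed_christoffel 1 k j w * half_deriv 0 i k w))
    + \sum_a (D (e a) (half_deriv (rev_ord a) i j) w
    - \sum_l half_deriv (rev_ord a) j l w * mixed_christoffel a l i w).
  rewrite [LHS]big_split_ord; congr (_ + _); apply: eq_bigr => k _.
    exact: partJ.
  exact: partE.
rewrite [X in X + _]big_split sum2 rev0 rev1 -/gam /=.
under [X in _ = _ + X]eq_bigr do rewrite -addrA -opprD.
rewrite [X in _ = _ + X]big_split /= sumrN [X in _ = _ + (_ - X)]big_split /=.
set S0 := \sum_l (half_deriv 1 _ _ _ * _); set S1 := \sum_l (half_deriv 0 _ _ _ * _).
have -> : \sum_k mixed_christoffel 0 k i w * half_deriv 1 j k w = S0.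
  by apply: eq_bigr => k _; rewrite mulrC.
have -> : \sum_k mixed_christoffel 1 k i w * half_deriv 0 j k w = S1.
  by apply: eq_bigr => k _; rewrite mulrC.
rewrite -[X in X + _ + _ = _]/(ricci (fun i => D (lshift 2 i)) H i j w).
by ring.
Qed.

(** An equation of Raychaudhuri type: with K = [mixed_christoffel 1], the component is -(tr K)' -
    tr(K^2), the prime being the derivative in the second null direction. *)
Lemma ricci_block_ee w : O w ->
  ricci D G (e 1) (e 1) w = - \sum_k (D (e 1) (mixed_christoffel 1 k k) w
    + \sum_l mixed_christoffel 1 k l w * mixed_christoffel 1 l k w).
Proof.
move=> Ow; rewrite /ricci big_split_ord /= [X in _ + X]big1 ?addr0; last first.
  move=> a _; rewrite (D_ext _ Ow (fun v Ov => christoffel_eee a 1 1 Ov)).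
  rewrite (D_ext _ Ow (fun v Ov => christoffel_eee a 1 a Ov)) !D0 // subr0 add0r.
  rewrite big_split_ord /= !big1 ?addr0 // => l _.
    by rewrite !christoffel_eee // !mul0r subr0.
  by rewrite !christoffel_eeJ // !mul0r subr0.
rewrite -sumrN; apply: eq_bigr => k _.
rewrite (D_ext _ Ow (fun v Ov => christoffel_Jee k 1 1 Ov)) D0 // add0r.
rewrite (D_ext _ Ow (fun v Ov => christoffel_JeJ k k 1 Ov)) opprD; congr (_ + _).
rewrite big_split_ord /= [X in _ + X]big1 ?addr0; last first.
  by move=> a _; rewrite christoffel_eee // christoffel_Jee // mulr0 mul0r subr0.
rewrite -sumrN; apply: eq_bigr => l _.
by rewrite christoffel_Jee // !christoffel_JeJ // mulr0 sub0r.
Qed.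

End BlockMetric.

(** * Formal series modulo powers of u *)

Section Congruence.
Variable R : realType.
Implicit Types a b : fps R.

Definition pcong m a b := forall k, (k < m)%N -> fcoef a k = fcoef b k.

Lemma pcong_refl m a : pcong m a a.
Proof. by []. Qed.

Lemma pcongD m a a' b b' :
  pcong m a a' -> pcong m b b' -> pcong m (a + b) (a' + b').
Proof. by move=> ha hb k km; rewrite /= ha // hb. Qed.

Lemma pcongN m a a' : pcong m a a' -> pcong m (- a) (- a').
Proof. by move=> ha k km; rewrite /= ha. Qed.

Lemma pcongM m a a' b b' :
  pcong m a a' -> pcong m b b' -> pcong m (a * b) (a' * b').
Proof.
move=> ha hb k km; rewrite !fcoefM; apply: eq_bigr => i _.
by rewrite ha ?hb // (leq_ltn_trans _ km) ?leq_subr // -ltnS.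
Qed.

Lemma pcong_sum m (n : nat) (f g : 'I_n -> fps R) :
  (forall i, pcong m (f i) (g i)) -> pcong m (\sum_i f i) (\sum_i g i).
Proof.
by move=> fg k km; rewrite !fcoef_sum; apply: eq_bigr => i _; exact: fg.
Qed.

Lemma pcongW m n a b : (m <= n)%N -> pcong n a b -> pcong m a b.
Proof. by move=> mn ab k km; apply: ab; exact: leq_trans mn. Qed.

Lemma pcong_deriv m a b : pcong m.+1 a b -> pcong m (fps_deriv a) (fps_deriv b).
Proof. by move=> ab k km; rewrite /= ab. Qed.

(** In degree m the two Cauchy products can differ only in the summand that pairs the constant term
    of a with the coefficient of degree m of b. This linearises products at the first order where
    two solutions may differ. *)
Lemma fcoefM_top m a a' b b' : pcong m.+1 a a' -> pcong m b b' ->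
  fcoef (a * b) m - fcoef (a' * b') m = fcoef a 0 * (fcoef b m - fcoef b' m).
Proof.
move=> ha hb; rewrite !fcoefM !big_ord_recl !subn0 -ha //.
rewrite opprD addrACA -mulrBr -sumrB big1 ?addr0 // => i _.
rewrite ha; last by rewrite /= /bump add1n ltnS.
by rewrite hb ?subrr // ltn_subrL /= /bump; case: (m) i => [[]|].
Qed.

Lemma fcoefM_topr m a a' b b' : pcong m b b' -> pcong m.+1 a a' ->
  fcoef (b * a) m - fcoef (b' * a') m = fcoef a 0 * (fcoef b m - fcoef b' m).
Proof. by move=> hb ha; rewrite mulrC [b' * _]mulrC; exact: fcoefM_top. Qed.

Lemma pcong_mulmx m (n : nat) (H H' K K' : 'M[fps R]_n) :
  (forall i j, pcong m (H i j) (H' i j)) -> (forall i j, pcong m (K i j) (K' i j)) ->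
  forall i j, pcong m ((H *m K) i j) ((H' *m K') i j).
Proof.
move=> hH hK i j; rewrite !mxE; apply: pcong_sum => k.
by apply: pcongM; [exact: hH|exact: hK].
Qed.

(** Both inverses are sandwiched between the same factors: H^-1 = H^-1 K K^-1 and K^-1 = H^-1 H
    K^-1. *)
Lemma pcong_invmx m (n : nat) (H K : 'M[fps R]_n) :
  H \in unitmx -> K \in unitmx -> (forall i j, pcong m (H i j) (K i j)) ->
  forall i j, pcong m (invmx H i j) (invmx K i j).
Proof.
move=> Hu Ku HK i j.
have -> : invmx H = invmx H *m (K *m invmx K) by rewrite mulmxV // mulmx1.
have KE : invmx K = invmx H *m (H *m invmx K) by rewrite mulmxA mulVmx // mul1mx.
rewrite [in X in pcong _ _ X]KE.
apply: pcong_mulmx => [p q|p q]; first exact: pcong_refl.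
apply: pcong_mulmx => [p' q'|p' q']; last exact: pcong_refl.
by move=> k km; rewrite HK.
Qed.

Lemma unitmx_fps (n : nat) (H : 'M[fps R]_n) :
  map_mx (@fps_const R) H \in unitmx -> H \in unitmx.
Proof.
rewrite !unitmxE det_map_mx unitfE; exact: fps_unitE.
Qed.

Lemma invmx_fps_const (n : nat) (H : 'M[fps R]_n) : H \in unitmx ->
  map_mx (@fps_const R) (invmx H) = invmx (map_mx (@fps_const R) H).
Proof.
move=> Hu; have E : map_mx (@fps_const R) H *m map_mx (@fps_const R) (invmx H) = 1%:M.
  by rewrite -map_mxM mulmxV // map_mx1.
have [Hu' _] := mulmx1_unit E.
by rewrite -[RHS]mulmx1 -E mulmxA mulVmx // mul1mx.
Qed.

Lemma fps_half : 2^-1 = fpsC 2^-1 :> fps R.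
Proof. by rewrite rmorphV ?unitfE ?pnatr_eq0 // rmorph_nat. Qed.

Variable O : set 'rV[R]_6.
Hypothesis openO : open O.

Lemma pcong_formal_space m (i : 'I_6) (f g : 'rV[R]_6 -> fps R) w : O w ->
  (forall w, O w -> pcong m (f w) (g w)) ->
  pcong m (formal_partial (lshift 1 i) f w) (formal_partial (lshift 1 i) g w).
Proof.
move=> Ow fg k km; rewrite !formal_partial_space /=.
by apply: (partial_near i openO Ow) => v Ov; exact: fg.
Qed.

(** The map [s] selects directions other than u. Derivatives in these act on each coefficient
    separately and lose no order, unlike d/du. *)
Lemma pcong_christoffel m (n : nat) (s : 'I_n -> 'I_6)
    (H K : 'rV[R]_6 -> 'M[fps R]_n) k i j w :
  let D i := formal_partial (lshift 1 (s i)) in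
  (forall w, O w -> H w \in unitmx) -> (forall w, O w -> K w \in unitmx) ->
  (forall w i j, O w -> pcong m (H w i j) (K w i j)) -> O w ->
  pcong m (christoffel D H k i j w) (christoffel D K k i j w).
Proof.
move=> D Hu Ku HK Ow; apply: pcongM; first exact: pcong_refl.
apply: pcong_sum => l.
apply: pcongM; first by apply: pcong_invmx; [exact: Hu|exact: Ku|move=> *; exact: HK].
apply: pcongD; last apply: pcongN; first apply: pcongD;
  by apply: pcong_formal_space => // v Ov; exact: HK.
Qed.

Lemma pcong_ricci m (n : nat) (s : 'I_n -> 'I_6)
    (H K : 'rV[R]_6 -> 'M[fps R]_n) i j w :
  let D i := formal_partial (lshift 1 (s i)) in
  (forall w, O w -> H w \in unitmx) -> (forall w, O w -> K w \in unitmx) ->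
  (forall w i j, O w -> pcong m (H w i j) (K w i j)) -> O w ->
  pcong m (ricci D H i j w) (ricci D K i j w).
Proof.
move=> D Hu Ku HK Ow.
have gam k i' j' v : O v ->
    pcong m (christoffel D H k i' j' v) (christoffel D K k i' j' v).
  by move=> Ov; exact: pcong_christoffel.
apply: pcong_sum => k; apply: pcongD.
  apply: pcongD; last apply: pcongN; apply: pcong_formal_space => // v Ov;
    exact: gam.
apply: pcong_sum => l; apply: pcongD; last apply: pcongN; apply: pcongM;
  exact: gam.
Qed.

End Congruence.

(** * Homogeneity in t *)

Section ScalingDerivative.
Variable R : realType.

(** A directional derivative sees only the line through w. Along the t-axis, factors that depend on
    the point of J alone can thus be frozen to constants. *)
Lemma derive_line (V : normedModType R) (f g : V -> R) (w e : V) :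
  (forall h : R, f (h *: e + w) = g (h *: e + w)) -> 'D_e f w = 'D_e g w.
Proof.
move=> fg; have fgw : f w = g w by have := fg 0; rewrite scale0r add0r.
rewrite /derive.
suff -> : (fun h : R => h^-1 *: ((f \o shift w) (h *: e) - f w)) =
          (fun h : R => h^-1 *: ((g \o shift w) (h *: e) - g w)) by [].
by apply/funext => h; rewrite /= fg fgw.
Qed.

Lemma is_derive_exprz_1 (z : int) : is_derive (1 : R) 1 (fun t : R => t ^ z) z%:~R.
Proof.
case: z => n.
  apply: DeriveDef; first exact: exprn_derivable.
  by rewrite [LHS]exp_derive expr1n /GRing.scale /= !mulr1 pmulrn.
have d1 : derivable (fun t : R => t ^+ n.+1) 1 1 by exact: exprn_derivable.
apply: DeriveDef.
  by apply: derivableV; rewrite ?expr1n ?oner_eq0.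
rewrite [LHS](@deriveV _ _ (fun t : R => t ^+ n.+1)) ?expr1n ?oner_eq0 //.
rewrite exp_derive !expr1n NegzE rmorphN /= invr1 /GRing.scale /= !mulr1.
by rewrite mulN1r pmulrn.
Qed.

Lemma Jproj6_line (w : 'rV[R]_6) (h : R) :
  Jproj6 (h *: delta_mx 0 5 + w) = Jproj6 w.
Proof.
apply/rowP => k; rewrite !mxE.
suff /negPf -> : lshift 1 k != 5 by rewrite andbF mulr0 add0r.
by apply: contraTneq (ltn_ord k) => /(congr1 val) /= ->.
Qed.

Lemma partial_t_scaled (z : int) (c : 'rV[R]_5 -> R) (w : 'rV[R]_6) :
  w 0 5 = 1 ->
  partial (5 : 'I_6) (fun x => x 0 5 ^ z * c (Jproj6 x)) w =
  z%:~R * c (Jproj6 w).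
Proof.
move=> w5; rewrite /partial (@derive_line 'rV[R]_6 _
  (fun x : 'rV[R]_6 => x 0 5 ^ z * c (Jproj6 w))); last first.
  by move=> h; rewrite Jproj6_line.
have [dz dzE] := is_derive_exprz_1 z.
have dc : differentiable (fun x : 'rV[R]_6 => x 0 5) w by exact: differentiable_coord.
have dz' : derivable (fun t : R => t ^ z) (w 0 5) 1 by rewrite w5.
have df : derivable (fun x : 'rV[R]_6 => x 0 5 ^ z) w (delta_mx 0 5).
  apply: diff_derivable.
  apply: (@differentiable_comp _ _ _ _ (fun x : 'rV[R]_6 => x 0 5)
    (fun t : R => t ^ z)); first exact: dc.
  exact/derivable1_diffP.
rewrite deriveMr //.
have := @partial_comp R 5 5 (fun t : R => t ^ z) _ w dc dz'.
rewrite /partial => -> ; rewrite -/(partial _ _ _) partial_coord eqxx w5.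
by rewrite derive1E dzE mulr1 mulrC.
Qed.

End ScalingDerivative.

Section Uniqueness.
Variable R : realType.

(* [M * (5 / 2 - M)] never vanishes because the dimension 5 is odd; tracing the
   equation gives M * (5 - M) * T = 0, hence the extra hypothesis on T. *)
Lemma indicial_injective (g Phi : 'M[R]_5) (m : nat) :
  let M : R := m.+1%:R in
  let T := \sum_k \sum_l invmx g k l * Phi k l in
  g \in unitmx -> g^T = g ->
  (forall i j, M * (5 / 2 - M) * Phi i j + M / 2 * T * g i j = 0) ->
  ((0 < m)%N -> T = 0) -> Phi = 0.
Proof.
move=> M T gu gT E T0; have gs k l : g k l = g l k by rewrite -{1}gT mxE.
have trg : \sum_k \sum_l invmx g k l * g k l = 5.
  have -> : 5 = \tr (1%:M : 'M[R]_5) by rewrite mxtrace1.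
  rewrite -(mulVmx gu) /mxtrace; apply: eq_bigr => k _.
  by rewrite mxE; apply: eq_bigr => l _; rewrite gs.
have lin (a b : R) :
    \sum_k \sum_l invmx g k l * (a * Phi k l + b * g k l) = a * T + b * 5.
  rewrite -trg /T !mulr_sumr -big_split; apply: eq_bigr => k _.
  by rewrite !mulr_sumr -big_split; apply: eq_bigr => l _ /=; ring.
have trE : M * (5 - M) * T = 0.
  have -> : M * (5 - M) * T = M * (5 / 2 - M) * T + M / 2 * T * 5 by field.
  by rewrite -lin big1 // => k _; rewrite big1 // => l _; rewrite E mulr0.
have T_eq0 : T = 0.
  (* Only order M = 1 is left to the traced equation, which reads 4 T = 0 there. *)
  have [m0|/T0 //] := posnP m.
  move: trE; rewrite (_ : M = 1) /M ?m0 // => /eqP.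
  rewrite mul1r mulf_eq0 => /orP[|/eqP //].
  by rewrite (_ : 5 - 1 = 4) ?pnatr_eq0 //; ring.
have M0 : M * (5 / 2 - M) != 0.
  rewrite mulf_neq0 ?pnatr_eq0 //.
  have -> : 5 / 2 - M = (5 - (2 * m.+1)%:R) / 2 by rewrite natrM -/M; field.
  rewrite mulf_neq0 ?invr_eq0 ?pnatr_eq0 // subr_eq0 eqr_nat.
  by apply/eqP => /(congr1 odd); rewrite oddM.
apply/matrixP => i j; rewrite mxE; apply/eqP.
have := E i j; rewrite T_eq0 mulr0 mul0r addr0 => /eqP.
by rewrite mulf_eq0 (negPf M0).
Qed.

Definition FG_block (nu : nat -> 'rV[R]_5 -> 'M[R]_5) (w : 'rV[R]_6) :
    'M[fps R]_5 :=
  \matrix_(i, j) Fps (fun k => w 0 5 ^ (2%:Z - k%:Z) * nu k (Jproj6 w) i j).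

Lemma FG_series_block nu : FG_series nu = block_metric (FG_block nu).
Proof.
apply/funext => w; apply/matrixP => i j; apply: fpsP => k.
transitivity ((if k is 0%N then
    - ((i == 5%N :> nat)%:R * (j == 6%N :> nat)%:R
       + (i == 6%N :> nat)%:R * (j == 5%N :> nat)%:R) else 0) +
    w 0 5 ^ (2%:Z - k%:Z) * pull (nu k (Jproj6 w)) i j).
  rewrite mxE [LHS]/= mx_entryE [(_ *: pull _) _ _]mx_entryE; congr (_ + _).
  case: k => [|k]; last by rewrite mxE.
  by rewrite mx_entryE mulNr symprod_dt_du.
have lt5 (p : 'I_5) q : (p == (5 + q)%N :> nat) = false.
  by apply/negP => /eqP pq; have := ltn_ord p; rewrite pq ltnNge leq_addr.
case: (@split_ordP 5 2 i) => {}i ->; case: (@split_ordP 5 2 j) => {}j ->.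
- have -> : block_metric (FG_block nu) w (lshift 2 i) (lshift 2 j) =
    FG_block nu w i j by exact: block_mxEul.
  have -> : pull (nu k (Jproj6 w)) (lshift 2 i) (lshift 2 j) =
    nu k (Jproj6 w) i j by exact: block_mxEul.
  rewrite mxE /= !(lt5 _ 0%N) !(lt5 _ 1%N) !mul0r addr0 oppr0.
  by case: (k) => [|?]; rewrite add0r.
- have -> : block_metric (FG_block nu) w (lshift 2 i) (rshift 5 j) = 0.
    by rewrite [LHS]block_mxEur mxE.
  have -> : pull (nu k (Jproj6 w)) (lshift 2 i) (rshift 5 j) = 0.
    by rewrite [LHS]block_mxEur mxE.
  rewrite /= !(lt5 _ 0%N) !(lt5 _ 1%N) !mul0r addr0 oppr0 mulr0.
  by case: (k) => [|?]; rewrite add0r.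
- have -> : block_metric (FG_block nu) w (rshift 5 i) (lshift 2 j) = 0.
    by rewrite [LHS]block_mxEdl mxE.
  have -> : pull (nu k (Jproj6 w)) (rshift 5 i) (lshift 2 j) = 0.
    by rewrite [LHS]block_mxEdl mxE.
  rewrite /= !(lt5 _ 0%N) !(lt5 _ 1%N) !mulr0 !addr0 oppr0.
  by case: (k).
have -> : block_metric (FG_block nu) w (rshift 5 i) (rshift 5 j) =
    fpsC (- (i != j)%:R).
  by rewrite [LHS]block_mxEdr mxE rmorphN rmorph_nat.
have -> : pull (nu k (Jproj6 w)) (rshift 5 i) (rshift 5 j) = 0.
  by rewrite [LHS]block_mxEdr mxE.
rewrite mulr0 addr0; case: k => [|k] //=.
by case: i j => -[|[|//]] ? [[|[|//]] ?] /=; ring.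
Qed.

End Uniqueness.

(** * The induction step: coefficients of order m + 1 *)

Section UniquenessStep.
Variables (R : realType) (U : set R) (g : 'rV[R]_5 -> 'M[R]_5).
Hypotheses (openU : open U) (g_unit : forall v, Jset U v -> g v \in unitmx).

Let O := JRset U.
Let openO : open O := open_JRset openU.
Let D : 'I_(5 + 2) -> ('rV[R]_6 -> fps R) -> 'rV[R]_6 -> fps R :=
  @formal_partial R.

Let dirJ (i : 'I_5) : D (lshift 2 i) = formal_partial (lshift 1 (lshift 1 i)).
Proof. by congr formal_partial; exact: val_inj. Qed.
Let dirT : D (rshift 5 0) = formal_partial (lshift 1 (5 : 'I_6)).
Proof. by congr formal_partial; exact: val_inj. Qed.
Let dirU : D (rshift 5 1) = formal_partial (rshift 6 (0 : 'I_1)).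
Proof. by congr formal_partial; exact: val_inj. Qed.

Lemma FG_block_unit nu w : FG_coefficients U g nu -> O w ->
  FG_block nu w \in unitmx.
Proof.
move=> [nu0 _] [Uw w5]; apply: unitmx_fps.
have -> : map_mx (@fps_const R) (FG_block nu w) = w 0 5 ^+ 2 *: g (Jproj6 w).
  by apply/matrixP => i j; rewrite !mxE /fps_const /= nu0.
by rewrite unitmxZ ?g_unit // unitfE expf_neq0 // gt_eqF.
Qed.

Let D_cst i (b : fps R) w : b = 0 \/ b = -1 -> O w -> D i (fun=> b) w = 0.
Proof.
have dD := derivation_formal_partial i openO.
case=> -> Ow; first by have := der_cst dD 0 Ow; rewrite rmorph0.
by have := der_cst dD (-1) Ow; rewrite rmorphN1.
Qed.

Let D_local i f h : (forall w, O w -> f w = h w) -> forall w, O w -> D i f w = D i h w.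
Proof. exact: (der_local (derivation_formal_partial i openO)). Qed.

Variables (v : 'rV[R]_5) (m : nat).
Hypothesis Uv : Jset U v.

(* By homogeneity in t, it suffices to compare coefficients at t = 1. *)
Let w : 'rV[R]_6 := row_mx v (const_mx 1).
Let wv : Jproj6 w = v. Proof. exact: row_mxKl. Qed.
Let w5 : w 0 5 = 1.
Proof.
have -> : (5 : 'I_6) = rshift 5 (0 : 'I_1) by exact: val_inj.
by rewrite [LHS]row_mxEr mxE.
Qed.
Let Ow : O w. Proof. by split; rewrite ?wv ?w5. Qed.

Local Notation half s a i j := (half_deriv D (FG_block s) a i j).
Local Notation mixed s a k i := (mixed_christoffel D (FG_block s) a k i).

Let dT_coef s i j k : fcoef (D (rshift 5 0) (fun x => FG_block s x i j) w) k =
  (2%:Z - k%:Z)%:~R * s k v i j.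
Proof.
rewrite dirT formal_partial_space.
rewrite -[LHS]/(partial 5 (fun x => fcoef (FG_block s x i j) k) w).
have -> : (fun x => fcoef (FG_block s x i j) k) =
    (fun x => x 0 5 ^ (2%:Z - k%:Z) * s k (Jproj6 x) i j).
  by apply/funext => x; rewrite mxE.
by rewrite (@partial_t_scaled _ _ (fun y => s k y i j)) // wv.
Qed.

Let dU_coef s i j k x : fcoef (D (rshift 5 1) (fun x => FG_block s x i j) x) k =
  k.+1%:R * (x 0 5 ^ (2%:Z - k.+1%:Z) * s k.+1 (Jproj6 x) i j).
Proof. by rewrite dirU formal_partial_u mxE. Qed.

Let halfT_coef s i j k : fcoef (half s 0 i j w) k =
  2^-1 * ((2%:Z - k%:Z)%:~R * s k v i j).
Proof. by rewrite /half_deriv fps_half fcoefCM dT_coef. Qed.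

Let halfU_coef s i j k x : fcoef (half s 1 i j x) k =
  2^-1 * (k.+1%:R * (x 0 5 ^ (2%:Z - k.+1%:Z) * s k.+1 (Jproj6 x) i j)).
Proof. by rewrite /half_deriv fps_half fcoefCM dU_coef. Qed.

Let dT_halfU s i j k : fcoef (D (rshift 5 0) (half s 1 i j) w) k =
  2^-1 * (k.+1%:R * ((2%:Z - k.+1%:Z)%:~R * s k.+1 v i j)).
Proof.
rewrite dirT formal_partial_space.
rewrite -[LHS]/(partial 5 (fun x => fcoef (half s 1 i j x) k) w).
have -> : (fun x => fcoef (half s 1 i j x) k) = (fun x =>
    x 0 5 ^ (2%:Z - k.+1%:Z) * (2^-1 * (k.+1%:R * s k.+1 (Jproj6 x) i j))).
  by apply/funext => x; rewrite halfU_coef; ring.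
rewrite (@partial_t_scaled _ _ (fun y => 2^-1 * (k.+1%:R * s k.+1 y i j))) // wv.
by ring.
Qed.

Let dU_halfT s i j k : fcoef (D (rshift 5 1) (half s 0 i j) w) k =
  2^-1 * (k.+1%:R * ((2%:Z - k.+1%:Z)%:~R * s k.+1 v i j)).
Proof.
rewrite dirU formal_partial_u -[LHS]/(k.+1%:R * fcoef (half s 0 i j w) k.+1).
by rewrite halfT_coef; ring.
Qed.

Variables nu mu : nat -> 'rV[R]_5 -> 'M[R]_5.
Hypotheses (FGnu : FG_coefficients U g nu) (FGmu : FG_coefficients U g mu).
Hypotheses (flat_nu : FG_ricci_flat U nu) (flat_mu : FG_ricci_flat U mu).
Hypothesis nu_mu : forall k y, (k <= m)%N -> Jset U y -> nu k y = mu k y.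

Let gi := invmx (g v).
Let M : R := m.+1%:R.
Let Phi := nu m.+1 v - mu m.+1 v.

Let PhiE i j : Phi i j = nu m.+1 v i j - mu m.+1 v i j.
Proof. by rewrite mxE [(- mu _ _) _ _]mxE. Qed.

(** From here on, quantities free of d/du agree modulo u^(m+1), and those containing one d/du agree
    modulo u^m. In degree m, a product of one of each kind therefore differs only through its second
    kind of factor, as [fcoefM_top] requires. *)
Let cH x i j : O x -> pcong m.+1 (FG_block nu x i j) (FG_block mu x i j).
Proof. by move=> [Ux _] k km; rewrite !mxE /= nu_mu. Qed.

Let cI k l : pcong m.+1 (invmx (FG_block nu w) k l) (invmx (FG_block mu w) k l).
Proof.
apply: pcong_invmx => [||i j]; last exact: cH.
  exact: FG_block_unit.
exact: FG_block_unit.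
Qed.

Let cT i j : pcong m.+1 (D (rshift 5 0) (fun x => FG_block nu x i j) w)
                        (D (rshift 5 0) (fun x => FG_block mu x i j) w).
Proof.
by rewrite dirT; apply: (pcong_formal_space openO) => // x Ox; exact: cH.
Qed.

Let cU i j : pcong m (D (rshift 5 1) (fun x => FG_block nu x i j) w)
                     (D (rshift 5 1) (fun x => FG_block mu x i j) w).
Proof. by rewrite dirU !formal_partial_u; apply: pcong_deriv; exact: cH. Qed.

Let cmixedT k i : pcong m.+1 (mixed nu 0 k i w) (mixed mu 0 k i w).
Proof.
apply: pcongM; first exact: pcong_refl.
by apply: pcong_sum => l; apply: pcongM; [exact: cI|exact: cT].
Qed.

Let cmixedU k i : pcong m (mixed nu 1 k i w) (mixed mu 1 k i w).
Proof.
apply: pcongM; first exact: pcong_refl.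
apply: pcong_sum => l; apply: pcongM; last exact: cU.
exact: pcongW (leqnSn m) (cI _ _).
Qed.

Let chalfT i j : pcong m.+1 (half nu 0 i j w) (half mu 0 i j w).
Proof. by apply: pcongM; [exact: pcong_refl|exact: cT]. Qed.

Let chalfU i j : pcong m (half nu 1 i j w) (half mu 1 i j w).
Proof. by apply: pcongM; [exact: pcong_refl|exact: cU]. Qed.

Let inv_const k l : fcoef (invmx (FG_block nu w) k l) 0 = gi k l.
Proof.
have Hu := FG_block_unit FGnu Ow.
have := invmx_fps_const Hu => /matrixP /(_ k l); rewrite [LHS]mxE => E.
rewrite -[LHS]/(fps_const _) E; congr (invmx _ _ _); apply/matrixP => i j.
rewrite mxE [FG_block _ _ _ _]mxE -[LHS]/(w 0 5 ^ (2 - 0) * nu 0 (Jproj6 w) i j).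
by rewrite w5 wv (proj1 FGnu) // exp1rz mul1r.
Qed.

Let g_sym : (g v)^T = g v.
Proof. by have [E /(_ 0) [+ _]] := FGnu => /(_ v Uv); rewrite E. Qed.

(** At u = 0 the block is t^2 g, whose t-derivative at t = 1 is 2 g. Raising an index then produces
    the identity in [mixedT0]. *)
Let halfT0 i j : fcoef (half nu 0 i j w) 0 = g v i j.
Proof.
by rewrite halfT_coef (proj1 FGnu) // mulrA (_ : 2^-1 * _ = 1) ?mul1r //; field.
Qed.

Let mixedT0 k i : fcoef (mixed nu 0 k i w) 0 = (k == i)%:R.
Proof.
rewrite /mixed_christoffel fps_half fcoefCM fcoef_sum.
have -> : (k == i)%:R = (gi *m g v) k i by rewrite mulVmx ?g_unit // mxE.
rewrite mxE mulr_sumr; apply: eq_bigr => l _.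
rewrite fcoefM big_ord1 subnn inv_const dT_coef (proj1 FGnu) //.
rewrite -[in LHS]g_sym [(g v)^T _ _]mxE.
by field.
Qed.

Let dhalfU i j :
  fcoef (half nu 1 i j w) m - fcoef (half mu 1 i j w) m = 2^-1 * (M * Phi i j).
Proof.
by rewrite !halfU_coef w5 wv !exp1rz PhiE /M; ring.
Qed.

Let dmixedU k i : fcoef (mixed nu 1 k i w) m - fcoef (mixed mu 1 k i w) m =
  2^-1 * \sum_l gi k l * (M * Phi i l).
Proof.
rewrite /mixed_christoffel fps_half !fcoefCM !fcoef_sum -mulrBr -sumrB.
congr (_ * _); apply: eq_bigr => l _.
rewrite (fcoefM_top (cI _ _) (cU _ _)) inv_const !dU_coef w5 wv !exp1rz.
by rewrite PhiE /M; ring.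
Qed.

Let ric s i j := ricci
  (fun i : 'I_5 => formal_partial (lshift 1 (lshift 1 i))) (FG_block s) i j w.

Let ricJ s i j : FG_coefficients U g s -> FG_ricci_flat U s ->
  ric s i j + D (rshift 5 0) (half s 1 i j) w + D (rshift 5 1) (half s 0 i j) w
  + \sum_k (mixed s 0 k k w * half s 1 i j w + mixed s 1 k k w * half s 0 i j w
    - mixed s 0 k j w * half s 1 i k w - mixed s 1 k j w * half s 0 i k w
    - mixed s 0 k i w * half s 1 j k w - mixed s 1 k i w * half s 0 j k w) = 0.
Proof.
move=> FGs flat; rewrite -[RHS](flat w Ow (lshift 2 i) (lshift 2 j)).
rewrite FG_series_block; symmetry.
rewrite [LHS](@ricci_block_JJ (fps R) _ O 5 D (FG_block s) D_cst D_local
  (fun x => FG_block_unit FGs) i j w Ow).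
have dE : (fun p : 'I_5 => D (lshift 2 p)) =
    (fun p => formal_partial (lshift 1 (lshift 1 p))).
  by apply/funext => p; exact: dirJ.
by rewrite dE.
Qed.

Let ricU s : FG_coefficients U g s -> FG_ricci_flat U s ->
  \sum_k (D (rshift 5 1) (mixed s 1 k k) w
           + \sum_l mixed s 1 k l w * mixed s 1 l k w) = 0.
Proof.
move=> FGs flat; apply/eqP; rewrite -oppr_eq0; apply/eqP.
rewrite -[RHS](flat w Ow (rshift 5 1) (rshift 5 1)) FG_series_block; symmetry.
exact: (@ricci_block_ee (fps R) _ O 5 D (FG_block s) D_cst D_local
  (fun x => FG_block_unit FGs) w Ow).
Qed.

Let fcoefD (a b : fps R) k : fcoef (a + b) k = fcoef a k + fcoef b k.
Proof. by []. Qed.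

Let fcoef_split (r t u : fps R) (p1 p2 p3 p4 p5 p6 : 'I_5 -> fps R) k :
  fcoef (r + t + u
    + \sum_i (p1 i + p2 i - p3 i - p4 i - p5 i - p6 i)) k =
  fcoef r k + fcoef t k + fcoef u k
    + \sum_i (fcoef (p1 i) k + fcoef (p2 i) k - fcoef (p3 i) k
              - fcoef (p4 i) k - fcoef (p5 i) k - fcoef (p6 i) k).
Proof. by rewrite fcoefD fcoef_sum. Qed.

Let delta_sum (f : 'I_5 -> R) i : \sum_k (k == i)%:R * f k = f i.
Proof.
rewrite (bigD1 i) //= eqxx mul1r big1 ?addr0 // => k /negPf ->.
by rewrite mul0r.
Qed.

Let contract (f : 'I_5 -> R) i : \sum_k g v i k * (\sum_l gi k l * f l) = f i.
Proof.
pose F : 'cV[R]_5 := \col_l f l.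
have -> : f i = (g v *m (gi *m F)) i 0.
  by rewrite mulmxA mulmxV ?g_unit // mul1mx mxE.
rewrite mxE; apply: eq_bigr => k _; congr (_ * _).
by rewrite mxE; apply: eq_bigr => l _; rewrite mxE.
Qed.

Let Phi_sym i j : Phi i j = Phi j i.
Proof.
have sym s : FG_coefficients U g s -> s m.+1 v i j = s m.+1 v j i.
  by move=> [_ /(_ m.+1) [+ _]] => /(_ v Uv) /matrixP /(_ j i); rewrite mxE.
by rewrite !PhiE !sym.
Qed.

Let T := \sum_k \sum_l gi k l * Phi k l.

Let T_sum : \sum_k (2^-1 * \sum_l gi k l * (M * Phi k l)) = M / 2 * T.
Proof.
rewrite /T mulr_sumr; apply: eq_bigr => k _; rewrite !mulr_sumr.
by apply: eq_bigr => l _; ring.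
Qed.

(** Subtraction of the two Ricci equations, over abstract reals. Here r is the part without d/du,
    which cancels; t and u are the two mixed second derivatives, each worth half of M z (y - y')
    with z = 2 - M; and d1, ..., d6 are the linearised products. *)
Let difference_eq (r r' t t' u u' y y' z : R) (p1 p2 p3 p4 p5 p6 : 'I_5 -> R)
    (q1 q2 q3 q4 q5 q6 d1 d2 d3 d4 d5 d6 : 'I_5 -> R) :
  r + t + u + \sum_k (p1 k + p2 k - p3 k - p4 k - p5 k - p6 k) = 0 ->
  r' + t' + u' + \sum_k (q1 k + q2 k - q3 k - q4 k - q5 k - q6 k) = 0 ->
  r = r' -> t = 2^-1 * (M * (z * y)) -> t' = 2^-1 * (M * (z * y')) ->
  u = 2^-1 * (M * (z * y)) -> u' = 2^-1 * (M * (z * y')) ->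
  (forall k, p1 k - q1 k = d1 k) -> (forall k, p2 k - q2 k = d2 k) ->
  (forall k, p3 k - q3 k = d3 k) -> (forall k, p4 k - q4 k = d4 k) ->
  (forall k, p5 k - q5 k = d5 k) -> (forall k, p6 k - q6 k = d6 k) ->
  M * z * (y - y') + \sum_k (d1 k + d2 k - d3 k - d4 k - d5 k - d6 k) = 0.
Proof.
move=> E E' rE tE tE' uE uE' h1 h2 h3 h4 h5 h6.
have EE' := congr2 (fun a b => a - b) E E'; rewrite /= subrr in EE'.
rewrite -[RHS]EE' rE tE tE' uE uE'.
rewrite [RHS](_ : _ = M * z * (y - y') +
  (\sum_k (p1 k + p2 k - p3 k - p4 k - p5 k - p6 k)
   - \sum_k (q1 k + q2 k - q3 k - q4 k - q5 k - q6 k))); last by field.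
congr (_ + _); rewrite -sumrB; apply: eq_bigr => k _.
by rewrite -h1 -h2 -h3 -h4 -h5 -h6; ring.
Qed.

(** In units of M Phi, the second derivatives give 2 - M, the trace of the identity times a
    u-derivative gives 5/2, and the four products with a free index give -1/2 each. The trace of the
    u-derivative times g gives the term in T. *)
Let indicial i j : M * (5 / 2 - M) * Phi i j + M / 2 * T * g v i j = 0.
Proof.
pose d (x : (nat -> 'rV[R]_5 -> 'M[R]_5) -> fps R) := fcoef (x nu) m - fcoef (x mu) m.
have Tk k p q : d (fun s => mixed s 0 k p w * half s 1 q.1 q.2 w) =
    (k == p)%:R * (2^-1 * (M * Phi q.1 q.2)).
  by rewrite /d (fcoefM_top (cmixedT _ _) (chalfU _ _)) mixedT0 dhalfU.
have Uk k p q : d (fun s => mixed s 1 k p w * half s 0 q.1 q.2 w) =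
    g v q.1 q.2 * (2^-1 * \sum_l gi k l * (M * Phi p l)).
  by rewrite /d (fcoefM_topr (cmixedU _ _) (chalfT _ _)) halfT0 dmixedU.
(* The Ricci tensor of the J-directions involves no d/du, so degree m still lies within the range of
   agreement. *)
have ric_eq : fcoef (ric nu i j) m = fcoef (ric mu i j) m.
  apply: (@pcong_ricci R O openO m.+1 5 (fun p : 'I_5 => lshift 1 p)
    (FG_block nu) (FG_block mu) i j w _ _ _ Ow m (ltnSn m)) => x.
  - exact: FG_block_unit.
  - exact: FG_block_unit.
  - by move=> p q Ox; exact: cH.
have coefJ s (FGs : FG_coefficients U g s) (flat : FG_ricci_flat U s) :=
  etrans (esym (fcoef_split (ric s i j) (D (rshift 5 0) (half s 1 i j) w)
    (D (rshift 5 1) (half s 0 i j) w)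
    (fun k => mixed s 0 k k w * half s 1 i j w)
    (fun k => mixed s 1 k k w * half s 0 i j w)
    (fun k => mixed s 0 k j w * half s 1 i k w)
    (fun k => mixed s 1 k j w * half s 0 i k w)
    (fun k => mixed s 0 k i w * half s 1 j k w)
    (fun k => mixed s 1 k i w * half s 0 j k w) m))
  (congr1 (fun a => fcoef a m) (ricJ i j FGs flat)).
have := difference_eq (coefJ nu FGnu flat_nu) (coefJ mu FGmu flat_mu) ric_eq
  (dT_halfU nu i j m) (dT_halfU mu i j m) (dU_halfT nu i j m) (dU_halfT mu i j m)
  (fun k => Tk k k (i, j)) (fun k => Uk k k (i, j)) (fun k => Tk k j (i, k))
  (fun k => Uk k j (i, k)) (fun k => Tk k i (j, k)) (fun k => Uk k i (j, k)).
rewrite -PhiE /=.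
rewrite !big_split /= !sumrN !delta_sum -mulr_sumr T_sum.
under eq_bigr do rewrite eqxx mul1r.
rewrite sumr_const card_ord.
have half_sum p q : \sum_k g v p k * (2^-1 * \sum_l gi k l * (M * Phi q l)) =
    2^-1 * (M * Phi q p).
  rewrite -[RHS](contract (fun l => 2^-1 * (M * Phi q l)) p).
  apply: eq_bigr => k _; congr (_ * _); rewrite mulr_sumr.
  by apply: eq_bigr => l _; rewrite mulrCA.
rewrite !half_sum (Phi_sym j i) => <-.
by rewrite -mulr_natr rmorphB /= -/M; field.
Qed.

Let fcoef_split2 (p : 'I_5 -> fps R) (q : 'I_5 -> 'I_5 -> fps R) k :
  fcoef (\sum_i (p i + \sum_l q i l)) k =
  \sum_i (fcoef (p i) k + \sum_l fcoef (q i l) k).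
Proof.
by rewrite fcoef_sum; apply: eq_bigr => i _; rewrite fcoefD fcoef_sum.
Qed.

Let difference_eq2 (c : R) (p p' x x' d : 'I_5 -> R) (q q' : 'I_5 -> 'I_5 -> R) :
  \sum_i (p i + \sum_l q i l) = 0 -> \sum_i (p' i + \sum_l q' i l) = 0 ->
  (forall i, p i = c * x i) -> (forall i, p' i = c * x' i) ->
  (forall i l, q i l = q' i l) -> (forall i, x i - x' i = d i) ->
  c * \sum_i d i = 0.
Proof.
move=> E E' pE pE' qE h.
have EE' := congr2 (fun a b => a - b) E E'; rewrite /= subrr in EE'.
rewrite -[RHS]EE' -sumrB mulr_sumr; apply: eq_bigr => k _.
rewrite pE pE' -h (eq_bigr (q' k)) => [|l _]; last exact: qE.
by ring.
Qed.

(** With m = p + 1, the coefficient of u^p in Ric_uu is compared. The derivative of the trace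
    contributes m M T / 2, while the quadratic terms involve only coefficients below order m, on
    which both solutions agree. *)
Let trace_eq0 : (0 < m)%N -> T = 0.
Proof.
case E: m => [//|p] _.
have coefU s (FGs : FG_coefficients U g s) (flat : FG_ricci_flat U s) :=
  etrans (esym (fcoef_split2 (fun k => D (rshift 5 1) (mixed s 1 k k) w)
    (fun k l => mixed s 1 k l w * mixed s 1 l k w) p))
  (congr1 (fun a => fcoef a p) (ricU FGs flat)).
have dU s k : fcoef (D (rshift 5 1) (mixed s 1 k k) w) p =
    p.+1%:R * fcoef (mixed s 1 k k w) m.
  by rewrite E dirU formal_partial_u.
have quad k l : fcoef (mixed nu 1 k l w * mixed nu 1 l k w) p =
    fcoef (mixed mu 1 k l w * mixed mu 1 l k w) p.
  have pm : (p < m)%N by rewrite E.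
  exact: (pcongM (cmixedU k l) (cmixedU l k) pm).
have := difference_eq2 (coefU nu FGnu flat_nu) (coefU mu FGmu flat_mu)
  (dU nu) (dU mu) quad (fun k => dmixedU k k).
rewrite T_sum => /eqP.
by rewrite !mulf_eq0 /M !pnatr_eq0 invr_eq0 pnatr_eq0 /= => /eqP.
Qed.

Lemma FG_step : nu m.+1 v = mu m.+1 v.
Proof.
apply/eqP; rewrite -subr_eq0; apply/eqP.
exact: (@indicial_injective R (g v) Phi m (g_unit Uv) g_sym indicial trace_eq0).
Qed.

End UniquenessStep.

Lemma FG_unique (R : realType) (U : set R) (g : 'rV[R]_5 -> 'M[R]_5) nu mu :
  open U -> (forall v, Jset U v -> g v \in unitmx) ->
  FG_coefficients U g nu -> FG_ricci_flat U nu ->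
  FG_coefficients U g mu -> FG_ricci_flat U mu ->
  forall k v, Jset U v -> nu k v = mu k v.
Proof.
move=> oU gu FGnu flat_nu FGmu flat_mu k.
(* The induction hypothesis ranges over all points of [Jset U], not just v, because the Ricci tensor
   differentiates the lower coefficients along J. Order 0 is prescribed by g. *)
elim/ltn_ind: k => -[|m] IH v Uv.
  by rewrite (proj1 FGnu) // (proj1 FGmu).
apply: (FG_step oU gu Uv FGnu FGmu flat_nu flat_mu) => k y km Uy.
exact: IH.
Qed.

Unset Implicit Arguments.

Theorem mainTheorem1 (R : realType) (U : set R) (F : R -> R)
  (openU : open U)
  (smoothF : smooth1_on U F)
  (F2_neq0 : forall q : R, U q -> derive1n 2 F q != 0) :
  [/\ (forall v : 'rV[R]_5, Jset U v -> has_signature 3 2 (g_metric F v)),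
      (forall w : 'rV[R]_7, JRRset U w -> has_signature 4 3 (gt_metric F w)),
      (forall w : 'rV[R]_7, JRRset U w -> forall i j : 'I_7,
         ricci (@partial R 6) (gt_metric F) i j w = 0)
    & is_ambient_metric U (g_metric F) (gt_metric F)].
Proof.
split.
- exact: g_metric_signature.
- exact: gt_metric_signature.
- by move=> w Uw i j; exact: (ambient_ricci_flat openU smoothF F2_neq0).
have FG := ambient_coefs_FG openU smoothF F2_neq0.
have flat := ambient_formal_ricci_flat openU smoothF F2_neq0.
exists (ambient_coefs F); split=> //.
- move=> nu FGnu flat_nu.
  apply: (FG_unique openU _ FGnu flat_nu FG flat) => v.
  exact: g_metric_unit.
- exact: ambient_sum.
Qed.
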